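(* For any $i\ne j$ in $\{1,\dots,n\}$, with $k=1+|c_{i,j}|$, the following identities hold in $X(\mathfrak{o}_N)$ for all integers $r_1,\dots,r_k,s\ge0$ and for each choice of sign $\pm$: $$\sum_{\sigma\in\mathfrak{S}_k}\big[\xi_{i,r_{\sigma(1)}}^{\pm},\big[\xi_{i,r_{\sigma(2)}}^{\pm},\dots,\big[\xi_{i,r_{\sigma(k)}}^{\pm},\xi_{j,s}^{\pm}\big]\dots\big]\big]=0.$$
   Context: $\Bbbk$ is an algebraically closed field of characteristic $p>3$. $N=2n+1$ with $n\ge1$ (type $B$) or $N=2n$ with $n\ge 2$ (type $D$); $i'=N+1-i$; $\kappa=N/2-1$ (viewed in $\Bbbk$). The extended Yangian $X(\mathfrak{o}_N)$ is the associative unital $\Bbbk$-algebra with generators $t_{i,j}^{(r)}$ ($1\le i,j\le N$, $r\ge1$) and, with $t_{i,j}(u)=\delta_{i,j}+\sum_{r\ge1}t_{i,j}^{(r)}u^{-r}$, defining relations $$[t_{i,j}(u),t_{k,l}(v)]=\frac{1}{u-v}\big(t_{k,j}(u)t_{i,l}(v)-t_{k,j}(v)t_{i,l}(u)\big)-\frac{1}{u-v-\kappa}\Big(\delta_{k,i'}\sum_{q=1}^N t_{q,j}(u)t_{q',l}(v)-\delta_{l,j'}\sum_{q=1}^N t_{k,q'}(v)t_{i,q}(u)\Big).$$ Let $T(u)=(t_{i,j}(u))=F(u)H(u)E(u)$ be the unique Gauss decomposition, with $H(u)$ diagonal, $E(u)$ upper unitriangular with entries $e_{i,j}(u)$ ($i<j$),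 $F(u)$ lower unitriangular with entries $f_{j,i}(u)$ ($i<j$). For $1\le i\le n-1$ set $\xi_i^+(u)=f_{i+1,i}(u-(i-1)/2)$ and $\xi_i^-(u)=e_{i,i+1}(u-(i-1)/2)$. If $N=2n+1$ set $\xi_n^+(u)=f_{n+1,n}(u-(n-1)/2)$, $\xi_n^-(u)=e_{n,n+1}(u-(n-1)/2)$; if $N=2n$ set $\xi_n^+(u)=f_{n+1,n-1}(u-(n-2)/2)$, $\xi_n^-(u)=e_{n-1,n+1}(u-(n-2)/2)$. Expanding in $u^{-1}$, define $\xi_{i,r}^{\pm}\in X(\mathfrak{o}_N)$ by $\xi_i^{\pm}(u)=\sum_{r\ge0}\xi_{i,r}^{\pm}u^{-r-1}$. Let $\epsilon_1,\dots,\epsilon_n$ be orthonormal for $(\cdot,\cdot)$; $\alpha_i=\epsilon_i-\epsilon_{i+1}$ for $i<n$; $\alpha_n=\epsilon_n$ if $N=2n+1$ and $\alpha_n=\epsilon_{n-1}+\epsilon_n$ if $N=2n$. The Cartan matrix is $c_{i,j}=(\alpha_i,\alpha_j)$ if $N=2n$; if $N=2n+1$, $c_{i,j}=(\alpha_i,\alpha_j)$ for $i<n$ and $c_{n,j}=2(\alpha_n,\alpha_j)$. $\mathfrak{S}_k$ is the symmetric group on $k$ letters. *)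

(* Defs.v *)
From HB Require Import structures.
From mathcomp Require Import ssrAC all_boot all_order all_algebra all_fingroup.
From mathcomp Require Import generic_quotient ring_quotient.
From mathcomp Require Import boolp.
From mathcomp Require Import monalg.

Set Implicit Arguments.
Unset Strict Implicit.
Unset Printing Implicit Defensive.

Import GRing.Theory.
Local Open Scope ring_scope.

(* Power series in u^-1 with matrix coefficients over a noncommutative ring:
   [S r] is the coefficient of u^-r. *)
Section Gauss.
Context (A : nzRingType) (N : nat).
Implicit Types T F H E S : nat -> 'M[A]_N.

Definition mulser S1 S2 : nat -> 'M[A]_N :=
  fun r => \sum_(a < r.+1) S1 a *m S2 (r - a)%N.

Definition lower_unitri S : Prop :=
  forall r, is_trig_mx (S r) /\ forall i, S r i i = (r == 0%N)%:R.

Definition upper_unitri S : Prop := lower_unitri (fun r => (S r)^T).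

Definition is_gauss T F H E : Prop :=
  [/\ forall r, T r = mulser (mulser F H) E r,
      lower_unitri F, forall r, is_diag_mx (H r) & upper_unitri E].

Let mid S1 S2 m := \sum_(a < m) S1 a.+1 *m S2 (m - a)%N.

Let mulser0 S1 S2 : mulser S1 S2 0 = S1 0 *m S2 0.
Proof. by rewrite /mulser big_ord_recl big_ord0 addr0. Qed.

Let mulserS S1 S2 m :
  mulser S1 S2 m.+1 = S1 0 *m S2 m.+1 + mid S1 S2 m + S1 m.+1 *m S2 0.
Proof.
rewrite /mulser big_ord_recl big_ord_recr /= subn0 /bump /= add1n subnn addrA.
by congr (_ + _ + _).
Qed.

Let eq_mid S1 S2 S1' S2' m :
  (forall a, (0 < a <= m)%N -> S1 a = S1' a) ->
  (forall a, (0 < a <= m)%N -> S2 a = S2' a) -> mid S1 S2 m = mid S1' S2' m.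
Proof.
move=> e1 e2; apply: eq_bigr => a _; rewrite e1 ?e2 //=.
by rewrite subn_gt0 ltn_ord leq_subr.
Qed.

Let eq_mulser S1 S2 S1' S2' m :
  (forall a, (a <= m)%N -> S1 a = S1' a) ->
  (forall a, (a <= m)%N -> S2 a = S2' a) -> mulser S1 S2 m = mulser S1' S2' m.
Proof.
move=> e1 e2; apply: eq_bigr => a _; rewrite e1 ?e2 ?leq_subr //.
by rewrite -ltnS.
Qed.

Let low F H E m := mid (mulser F H) E m + mid F H m.

Let eq_low F H E F' H' E' m :
  (forall a, (a <= m)%N -> F a = F' a) ->
  (forall a, (a <= m)%N -> H a = H' a) ->
  (forall a, (a <= m)%N -> E a = E' a) -> low F H E m = low F' H' E' m.
Proof.
move=> eF eH eE; congr (_ + _); apply: eq_mid => a /andP[_ am].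
- by apply: eq_mulser => b ba; rewrite ?eF ?eH // (leq_trans ba).
- exact: eE.
- exact: eF.
- exact: eH.
Qed.

Let mulser3S F H E m : F 0 = 1%:M -> H 0 = 1%:M -> E 0 = 1%:M ->
  mulser (mulser F H) E m.+1 = F m.+1 + H m.+1 + E m.+1 + low F H E m.
Proof.
move=> F0 H0 E0; rewrite mulserS mulser0 F0 H0 E0 !mul1mx mulmx1 mulserS F0 H0.
rewrite mul1mx mulmx1 /low.
by rewrite [LHS](AC (2*3) (5*3*1*(2*4))).
Qed.

Let pL (M : 'M[A]_N) := \matrix_(i, j) (if (j < i)%N then M i j else 0).
Let pD (M : 'M[A]_N) := \matrix_(i, j) (if i == j then M i j else 0).
Let pU (M : 'M[A]_N) := \matrix_(i, j) (if (i < j)%N then M i j else 0).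

Let pLDU M : pL M + pD M + pU M = M.
Proof.
apply/matrixP => i j; rewrite !mxE -val_eqE /=.
by case: (ltngtP i j); rewrite ?add0r ?addr0.
Qed.

Let z0 : nat -> 'M[A]_N := fun r => if r is 0 then 1%:M else 0.
Let upd S m M : nat -> 'M[A]_N := fun r => if r == m then M else S r.

Let approx T := fix approx r : (nat -> 'M[A]_N) * (nat -> 'M[A]_N) *
    (nat -> 'M[A]_N) :=
  if r is m.+1 then
    let: (F, H, E) := approx m in
    let D := T m.+1 - low F H E m in
    (upd F m.+1 (pL D), upd H m.+1 (pD D), upd E m.+1 (pU D))
  else (z0, z0, z0).

Lemma gauss_exists T : T 0 = 1%:M ->
  exists G : (nat -> 'M[A]_N) * (nat -> 'M[A]_N) * (nat -> 'M[A]_N),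
    is_gauss T G.1.1 G.1.2 G.2.
Proof.
move=> T0.
pose F r := (approx T r).1.1 r; pose H r := (approx T r).1.2 r.
pose E r := (approx T r).2 r.
have stab r d : [/\ (approx T (r + d)).1.1 r = F r,
    (approx T (r + d)).1.2 r = H r & (approx T (r + d)).2 r = E r].
  elim: d => [|d [<- <- <-]]; first by rewrite addn0.
  rewrite addnS /=; case: (approx T (r + d)) => -[f h] e /=.
  by rewrite /upd ltn_eqF // ltnS leq_addr.
have F0 : F 0 = 1%:M by [].
have H0 : H 0 = 1%:M by [].
have E0 : E 0 = 1%:M by [].
have FS m : let D := T m.+1 - low F H E m in
    [/\ F m.+1 = pL D, H m.+1 = pD D & E m.+1 = pU D].
  have st a : (a <= m)%N -> [/\ (approx T m).1.1 a = F a,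
      (approx T m).1.2 a = H a & (approx T m).2 a = E a].
    by move=> am; have := stab a (m - a)%N; rewrite subnKC.
  rewrite /F /H /E /= -/F -/H -/E.
  case: (approx T m) st => -[f h] e /= st; rewrite /upd eqxx.
  rewrite (@eq_low F H E f h e) //.
  - by move=> a /st[].
  - by move=> a /st[].
  - by move=> a /st[].
exists (F, H, E); split=> /=.
- case=> [|m]; first by rewrite !mulser0 F0 H0 E0 !mul1mx.
  by rewrite mulser3S //; have [-> -> ->] := FS m; rewrite pLDU subrK.
- case=> [|m]; last have [-> _ _] := FS m.
    rewrite F0; split; last by move=> i; rewrite mxE eqxx.
    apply/is_trig_mxP => i j ij; rewrite mxE -val_eqE /=.
    by rewrite ltn_eqF.
  split; last by move=> i; rewrite mxE ltnn.
  by apply/is_trig_mxP => i j ij; rewrite mxE ltnNge ltnW.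
- case=> [|m]; last have [_ -> _] := FS m.
    by rewrite H0; apply: scalar_mx_is_diag.
  by apply/is_diag_mxP => i j ij; rewrite mxE -val_eqE /= (negbTE ij).
- case=> [|m]; last have [_ _ ->] := FS m.
    rewrite E0; split; last by move=> i; rewrite !mxE eqxx.
    apply/is_trig_mxP => i j ij; rewrite !mxE -val_eqE /=.
    by rewrite gtn_eqF.
  split; last by move=> i; rewrite !mxE ltnn.
  by apply/is_trig_mxP => i j ij; rewrite !mxE ltnNge ltnW.
Qed.

(* H(u) is not assumed invertible: since T(u) = 1 + O(u^-1), all three factors
   have constant term 1. *)
Lemma gauss0 T F H E : T 0 = 1%:M -> is_gauss T F H E ->
  [/\ F 0 = 1%:M, H 0 = 1%:M & E 0 = 1%:M].
Proof.
move=> T0 [eT /(_ 0)[/is_trig_mxP Lt Ld] /(_ 0)/is_diag_mxP Dd].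
move=> /(_ 0)[/is_trig_mxP Ut Ud]; move: (eT 0); rewrite T0 !mulser0.
move: (F 0) (H 0) (E 0) Lt Ld Dd Ut Ud => L D U Lt Ld Dd Ut Ud.
have {}Ud i : U i i = 1 by have := Ud i; rewrite mxE.
have {}Ut (i j : 'I_N) : (j < i)%N -> U i j = 0 by move=> /Ut; rewrite mxE.
have {}Ld i : L i i = 1 by rewrite Ld.
move=> /matrixP e.
have {}e i j : (i == j)%:R = \sum_a L i a * D a a * U a j.
  move: (e i j); rewrite !mxE => ->; apply: eq_bigr => a _; congr (_ * _).
  rewrite mxE (bigD1 a) //= big1 ?addr0 // => b ba.
  by rewrite Dd ?mulr0.
have P m : forall b : 'I_N, b = m :> nat ->
    [/\ D b b = 1, forall i, L i b = (i == b)%:R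
      & forall j, U b j = (b == j)%:R].
  elim/ltn_ind: m => m IH b bm; rewrite -{}bm in IH.
  have Db : D b b = 1.
    move: (e b b); rewrite eqxx (bigD1 b) //= Ld Ud mul1r mulr1.
    rewrite big1 ?addr0 // => a ab.
    have [lt_ab|lt_ba|/val_inj E0] := ltngtP a b; last by rewrite E0 eqxx in ab.
      have [_ -> _] := IH a lt_ab a erefl.
      by rewrite eq_sym (negbTE ab) !mul0r.
    by rewrite Lt // !mul0r.
  split=> // [i|j].
    rewrite (e i b) (bigD1 b) //= Db Ud !mulr1 big1 ?addr0 // => a ab.
    have [lt_ab|lt_ba|/val_inj E0] := ltngtP a b; last by rewrite E0 eqxx in ab.
      have [_ _ ->] := IH a lt_ab a erefl.
      by rewrite (negbTE ab) mulr0.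
    by rewrite Ut // mulr0.
  rewrite (e b j) (bigD1 b) //= Db Ld !mul1r big1 ?addr0 // => a ab.
  have [lt_ab|lt_ba|/val_inj E0] := ltngtP a b; last by rewrite E0 eqxx in ab.
    have [_ -> _] := IH a lt_ab a erefl.
    by rewrite eq_sym (negbTE ab) !mul0r.
  by rewrite Lt // !mul0r.
split; apply/matrixP => i j; rewrite mxE.
- by have [_ -> _] := P _ j erefl.
- have [<-|ij] := eqVneq i j; first by have [->] := P _ i erefl.
  by rewrite Dd.
- by have [_ _ ->] := P _ i erefl.
Qed.

Lemma gauss_unique T F H E F' H' E' : T 0 = 1%:M ->
  is_gauss T F H E -> is_gauss T F' H' E' -> [/\ F = F', H = H' & E = E'].
Proof.
move=> T0 g g'; have [F0 H0 E0] := gauss0 T0 g.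
have [F0' H0' E0'] := gauss0 T0 g'.
have P r : [/\ F r = F' r, H r = H' r & E r = E' r].
  elim/ltn_ind: r => -[|m] IH; first by rewrite F0 H0 E0 F0' H0' E0'.
  case: g g' => eT gF gH gE [eT' gF' gH' gE'].
  move: (eT' m.+1); rewrite (eT m.+1) !mulser3S //.
  rewrite (@eq_low F H E F' H' E'); try by move=> a am; have [] := IH a am.
  move=> /addIr /matrixP e.
  have [[/is_trig_mxP Lt Ld] [/is_trig_mxP Lt' Ld']] := (gF m.+1, gF' m.+1).
  have [[/is_trig_mxP Ut Ud] [/is_trig_mxP Ut' Ud']] := (gE m.+1, gE' m.+1).
  move: (gH m.+1) (gH' m.+1) => /is_diag_mxP Dd /is_diag_mxP Dd'.
  have {Ut Ud}[Ut Ud] : (forall i j : 'I_N, (j < i)%N -> E m.+1 i j = 0)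
    /\ (forall i, E m.+1 i i = 0).
    by split=> [i j /Ut|i]; [|have := Ud i]; rewrite mxE.
  have {Ut' Ud'}[Ut' Ud'] : (forall i j : 'I_N, (j < i)%N -> E' m.+1 i j = 0)
    /\ (forall i, E' m.+1 i i = 0).
    by split=> [i j /Ut'|i]; [|have := Ud' i]; rewrite mxE.
  split; apply/matrixP => i j; move: (e i j); rewrite !mxE;
    have [lt|gt|/val_inj <-] := ltngtP i j;
    rewrite ?Ld ?Ld' ?Ud ?Ud' //; do ?[rewrite Lt // Lt' //];
    do ?[rewrite Ut // Ut' //]; rewrite ?addr0 ?add0r //;
    rewrite ?Dd ?Dd' ?addr0 ?add0r // -?val_eqE ?neq_ltn ?lt ?gt ?orbT //.
by split; apply: funext => r; have [] := P r.
Qed.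

End Gauss.

(* [f r s] is the coefficient of u^-r v^-s of a series f(u, v); the exponents
   are integers so that multiplication by u and by v is an index shift. *)
Section Relations.
Context (k : comNzRingType) (A : lalgType k) (N : nat).
Variable t : 'I_N -> 'I_N -> nat -> A.
Implicit Types (i j q : 'I_N) (r s : int) (f : int -> int -> A).

(* The coefficient of u^-r in t_{i,j}(u). Only the values [t i j r], r >= 1, are
   used. *)
Definition tcoef i j r : A :=
  match r with
  | Posz 0 => (i == j)%:R
  | Posz m => t i j m
  | Negz _ => 0
  end.

(* (u - v - c) f(u, v) *)
Definition mul_uvc (c : k) f r s : A := f (r + 1) s - f r (s + 1) - c *: f r s.

Definition tcomm i j l m r s : A :=
  tcoef i j r * tcoef l m s - tcoef l m s * tcoef i j r.

Definition tswap i j l m r s : A :=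
  tcoef l j r * tcoef i m s - tcoef l j s * tcoef i m r.

(* With indices starting at 0, i |-> i' = N + 1 - i is [rev_ord]. *)
Definition ttrace i j l m r s : A :=
  (l == rev_ord i)%:R * (\sum_q tcoef q j r * tcoef (rev_ord q) m s)
  - (m == rev_ord j)%:R * (\sum_q tcoef l (rev_ord q) s * tcoef i q r).

(* The coefficient of u^-r v^-s in the defining relation between t_{i,j}(u) and
   t_{l,m}(v), after multiplication by (u - v)(u - v - kappa):
     (u - v)(u - v - kappa) [t_{i,j}(u), t_{l,m}(v)]
       = (u - v - kappa) (t_{l,j}(u) t_{i,m}(v) - t_{l,j}(v) t_{i,m}(u))
         - (u - v) (delta_{l,i'} sum_q t_{q,j}(u) t_{q',m}(v)
                    - delta_{m,j'} sum_q t_{l,q'}(v) t_{i,q}(u)).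
   Since u - v and u - v - kappa are invertible for either expansion
   (in u^-1 or in v^-1) of their inverses, this is equivalent to the relation
   with denominators. *)
Definition yrel (kappa : k) i j l m r s : A :=
  mul_uvc 0 (mul_uvc kappa (tcomm i j l m)) r s
  - (mul_uvc kappa (tswap i j l m) r s - mul_uvc 0 (ttrace i j l m) r s).

End Relations.

Arguments tcoef {k A N} t i j r.
Arguments yrel {k A N} t kappa i j l m r s.

Lemma rmorph_yrel (k : comNzRingType) (A B : lalgType k) (g : {rmorphism A -> B})
    (N : nat) (t : 'I_N -> 'I_N -> nat -> A) kappa i j l m r s :
  (forall (c : k) x, g (c *: x) = c *: g x) ->
  g (yrel t kappa i j l m r s)
  = yrel (fun a b n => g (t a b n)) kappa i j l m r s.
Proof.
move=> gZ; have gt a b n : g (tcoef t a b n) = tcoef (fun a b n => g (t a b n)) a b n.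
  by case: n => [[|n]|n] /=; rewrite ?rmorph_nat ?rmorph0.
have gC a b : g (tcomm t i j l m a b)
    = tcomm (fun a b n => g (t a b n)) i j l m a b.
  by rewrite /tcomm rmorphB !rmorphM !gt.
have gS a b : g (tswap t i j l m a b)
    = tswap (fun a b n => g (t a b n)) i j l m a b.
  by rewrite /tswap rmorphB !rmorphM !gt.
have gT a b : g (ttrace t i j l m a b)
    = ttrace (fun a b n => g (t a b n)) i j l m a b.
  rewrite /ttrace rmorphB !rmorphM !rmorph_nat !rmorph_sum.
  by congr (_ * _ - _ * _); apply: eq_bigr => q _; rewrite rmorphM !gt.
have gM c f a b : g (mul_uvc c f a b) = mul_uvc c (fun a b => g (f a b)) a b.
  by rewrite /mul_uvc !rmorphB gZ.
have eM c f1 f2 a b : (forall a b, f1 a b = f2 a b :> B) ->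
  mul_uvc c f1 a b = mul_uvc c f2 a b.
  by move=> e; rewrite /mul_uvc !e.
rewrite /yrel rmorphB [g (_ - mul_uvc 0 _ _ _)]rmorphB !gM.
by congr (_ - (_ - _)); apply: (eM) => a' b' //; rewrite gM; apply: (eM).
Qed.

(* X(o_N) is the quotient of the free algebra on symbols (i, j, m), standing
   for t_{i+1,j+1}^{(m+1)} since indices in ['I_N] start at 0, by the two-sided
   ideal generated by the relations. *)
Definition ygen (N : nat) : choiceType := ('I_N * 'I_N * nat)%type.

Definition yfree (k : comNzRingType) (N : nat) : lalgType k :=
  {malg k[{fmonom (ygen N)}]}.

Lemma malg_mulC (k : comNzRingType) (K : monomType) (g : {malg k[K]}) (c : k) :
  g * c%:MP = c *: g.
Proof.
rewrite -mul_malgC !malgM_def fgmulgU fgmulUg.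
by apply: eq_bigr => m _; rewrite mulm1 mul1m mulrC.
Qed.

Lemma yfree_scalerAr (k : comNzRingType) (N : nat) (c : k) (x y : yfree k N) :
  c *: (x * y) = x * (c *: y).
Proof. by rewrite -!(@malg_mulC k _ _ c) mulrA. Qed.

Section Yangian.
Context (k : closedFieldType) (N : nat).
Local Notation F := (yfree k N).

Definition kappa : k := N%:R / 2%:R - 1.

(* meaningful for r >= 1 *)
Definition fgen (i j : 'I_N) (r : nat) : F :=
  mkmalgU (fmu ((i, j, r.-1) : ygen N)) 1.

Inductive in_ideal : F -> Prop :=
| ideal_rel i j l m r s : in_ideal (yrel fgen kappa i j l m r s)
| ideal0 : in_ideal 0
| idealD x y : in_ideal x -> in_ideal y -> in_ideal (x + y)
| idealM a x b : in_ideal x -> in_ideal (a * x * b).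

Definition ideal : {pred F} := fun x => `[< in_ideal x >].

Lemma ideal_zmod_closed : zmod_closed ideal.
Proof.
split=> [|x y /asboolP Ix /asboolP Iy]; apply/asboolP; first exact: ideal0.
apply: idealD => //; rewrite -[- y]mulr1 -mulN1r; exact: idealM.
Qed.

HB.instance Definition _ := GRing.isZmodClosed.Build F ideal ideal_zmod_closed.

Definition yangian : Type := {ideal_quot ideal}.

HB.instance Definition _ := GRing.Zmodule.on yangian.

Definition ypi (x : F) : yangian := (\pi_{ideal_quot ideal} x)%qT.
Local Notation yrepr x := (repr (x : {ideal_quot ideal})).

Let ypiK (x : yangian) : ypi (yrepr x) = x.
Proof. exact: reprK. Qed.

Let ypiP x y : ypi x = ypi y <-> in_ideal (x - y).
Proof.
split=> [/eqP|Ixy]; first by rewrite -Quotient.idealrBE => /asboolP.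
by apply/eqP; rewrite -Quotient.idealrBE; apply/asboolP.
Qed.

Let ypiD x y : ypi (x + y) = ypi x + ypi y.
Proof. exact: (raddfD \pi_{ideal_quot ideal}%qT). Qed.

Definition yone : yangian := ypi 1.
Definition ymul (x y : yangian) : yangian := ypi (yrepr x * yrepr y).
Definition yscale (c : k) (x : yangian) : yangian := ypi (c *: yrepr x).

Let idealMl a x : in_ideal x -> in_ideal (a * x).
Proof. by move=> Ix; rewrite -[a * x]mulr1; apply: idealM. Qed.

Let idealMr x b : in_ideal x -> in_ideal (x * b).
Proof. by move=> Ix; rewrite -[x]mul1r; apply: idealM. Qed.

Let reprP x : in_ideal (yrepr (ypi x) - x).
Proof. by apply/ypiP; rewrite ypiK. Qed.

Let ypiM x y : ypi (x * y) = ymul (ypi x) (ypi y).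
Proof.
apply/esym/ypiP.
rewrite (_ : _ - _ = (yrepr (ypi x) - x) * yrepr (ypi y)
                     + x * (yrepr (ypi y) - y)).
  by apply: idealD; [apply: idealMr | apply: idealMl]; apply: reprP.
by rewrite mulrBl mulrBr addrA subrK.
Qed.

Let ypiZ c x : ypi (c *: x) = yscale c (ypi x).
Proof.
apply/esym/ypiP; rewrite -scalerBr -[_ - x]mul1r scalerAl.
by apply: idealMl; apply: reprP.
Qed.

Let ymulA : associative ymul.
Proof.
move=> x y z; rewrite -[x]ypiK -[y]ypiK -[z]ypiK -!ypiM; congr ypi.
exact: mulrA.
Qed.

Let ymul1 : left_id yone ymul.
Proof. by move=> x; rewrite -[x]ypiK -ypiM mul1r. Qed.

Let ymulr1 : right_id yone ymul.
Proof. by move=> x; rewrite -[x]ypiK -ypiM mulr1. Qed.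

Let ymulDl : left_distributive ymul +%R.
Proof.
by move=> x y z; rewrite -[x]ypiK -[y]ypiK -[z]ypiK -ypiD -!ypiM -ypiD mulrDl.
Qed.

Let ymulDr : right_distributive ymul +%R.
Proof.
by move=> x y z; rewrite -[x]ypiK -[y]ypiK -[z]ypiK -ypiD -!ypiM -ypiD mulrDr.
Qed.

(* t_{i,j}^{(r)} |-> 0 defines a representation on k. *)
Let fgen0 i j r : mcoeff mone (fgen i j r) = 0.
Proof. by rewrite mcoeffU1 fm1_eq1. Qed.

Let yone_neq0 : yone != 0.
Proof.
have I0 x : in_ideal x -> mcoeff mone x = 0.
  elim=> {x} [i j l m r s||x y _ x0 _ y0|a x b _ x0].
  - pose g := (mcoeff mone : {malg k[{fmonom (ygen N)}]} -> k^o).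
    have gZ (c : k) x : g (c *: x) = c *: g x by exact: mcoeffZ.
    rewrite (@rmorph_yrel k F k^o g N fgen kappa i j l m r s gZ).
    set t := fun _ _ _ => _.
    have t0 a b n : tcoef t a b n = (a == b)%:R * (n == 0)%:R.
      case: n => [[|n]|n] /=; rewrite ?mulr1 ?mulr0 //.
      exact: fgen0.
    have C0 a b : tcomm t i j l m a b = 0 :> k.
      by rewrite /tcomm mulrC subrr.
    have S0 a b : tswap t i j l m a b = 0 :> k.
      rewrite /tswap !t0; apply/eqP; rewrite subr_eq0; apply/eqP.
      by rewrite [LHS](AC (2*2) ((1*4)*(3*2))).
    have T0 a b : ttrace t i j l m a b = 0 :> k.
      rewrite /ttrace (bigD1 j) //= big1 ?addr0; last first.
        by move=> q /negbTE qj; rewrite !t0 qj !mul0r.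
      rewrite (bigD1 i) //= big1 ?addr0; last first.
        by move=> q /negbTE qi; rewrite !t0 [i == q]eq_sym qi !mul0r mulr0.
      rewrite !t0 !eqxx !mul1r [_ == m]eq_sym; apply/eqP; rewrite subr_eq0.
      by apply/eqP; rewrite [LHS](AC (1*(1*2)) (3*(1*4*2))).
    have Z (c : k) (f : int -> int -> k^o) a b :
        (forall a b, f a b = 0) -> mul_uvc c f a b = 0.
      by move=> f0; rewrite /mul_uvc !f0 scaler0 !subr0.
    by rewrite /yrel !Z ?subr0 // => a b; apply: Z.
  - exact: mcoeff0.
  - by rewrite mcoeffD x0 y0 addr0.
  - by rewrite !rmorphM /= x0 mulr0 mul0r.
apply/eqP; have -> : 0 = ypi 0 by exact/esym/(raddf0 \pi_{ideal_quot ideal}%qT).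
move=> /ypiP; rewrite subr0 => /I0; rewrite mcoeff1 eqxx.
exact/eqP/oner_neq0.
Qed.

HB.instance Definition _ := GRing.Zmodule_isNzRing.Build yangian
  ymulA ymul1 ymulr1 ymulDl ymulDr yone_neq0.

Let yscaleA a b x : yscale a (yscale b x) = yscale (a * b) x.
Proof. by rewrite -[x]ypiK -!ypiZ scalerA. Qed.

Let yscale1 : left_id 1 yscale.
Proof. by move=> x; rewrite -[x]ypiK -ypiZ scale1r. Qed.

Let yscaleDr : right_distributive yscale +%R.
Proof.
by move=> a x y; rewrite -[x]ypiK -[y]ypiK -ypiD -!ypiZ -ypiD scalerDr.
Qed.

Let yscaleDl x : {morph yscale^~ x : a b / a + b}.
Proof. by move=> a b; rewrite -[x]ypiK -!ypiZ -ypiD scalerDl. Qed.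

HB.instance Definition _ := GRing.Zmodule_isLmodule.Build k yangian
  yscaleA yscale1 yscaleDr yscaleDl.

Let yscalerAl a (x y : yangian) : a *: (x * y) = (a *: x) * y.
Proof.
rewrite -[x]ypiK -[y]ypiK /GRing.scale /GRing.mul /=.
by rewrite -ypiM -!ypiZ -ypiM scalerAl.
Qed.

HB.instance Definition _ := GRing.Lmodule_isLalgebra.Build k yangian yscalerAl.

Let yscalerAr a (x y : yangian) : a *: (x * y) = x * (a *: y).
Proof.
rewrite -[x]ypiK -[y]ypiK /GRing.scale /GRing.mul /=.
by rewrite -ypiM -!ypiZ -ypiM yfree_scalerAr.
Qed.

HB.instance Definition _ := GRing.Lalgebra_isAlgebra.Build k yangian yscalerAr.

Let ypi_is_zmod_morphism : zmod_morphism ypi.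
Proof. exact: (raddfB \pi_{ideal_quot ideal}%qT). Qed.

Let ypi_is_monoid_morphism : monoid_morphism ypi.
Proof. by split=> // x y; rewrite ypiM. Qed.

HB.instance Definition _ :=
  GRing.isZmodMorphism.Build F yangian ypi ypi_is_zmod_morphism.
HB.instance Definition _ :=
  GRing.isMonoidMorphism.Build F yangian ypi ypi_is_monoid_morphism.

(* t_{i+1,j+1}^{(r)} for r >= 1 *)
Definition tgen (i j : 'I_N) (r : nat) : yangian := ypi (fgen i j r).

Lemma tgen_rel i j l m r s : yrel tgen kappa i j l m r s = 0.
Proof.
rewrite -(@rmorph_yrel k F yangian ypi); last exact: ypiZ.
have -> : 0 = ypi 0 by rewrite rmorph0.
by apply/ypiP; rewrite subr0; apply: ideal_rel.
Qed.

Definition tser (r : nat) : 'M[yangian]_N := \matrix_(i, j) tcoef tgen i j r.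

Lemma tser0 : tser 0 = 1%:M.
Proof. by apply/matrixP => i j; rewrite !mxE. Qed.

Definition gauss := projT1 (cid (gauss_exists tser0)).

(* T(u) = F(u) H(u) E(u); by [gauss_unique] these do not depend on the choice
   made by [cid]. *)
Definition fser : nat -> 'M[yangian]_N := gauss.1.1.
Definition hser : nat -> 'M[yangian]_N := gauss.1.2.
Definition eser : nat -> 'M[yangian]_N := gauss.2.

Lemma gaussP : is_gauss tser fser hser eser.
Proof. exact: (projT2 (cid (gauss_exists tser0))). Qed.

End Yangian.

(* The coefficient of u^-s in f(u - c), for f(u) = sum_r f_r u^-r:
   (u - c)^-r = sum_m binom(r + m - 1, m) c^m u^-(r + m). *)
Definition shift (k : comNzRingType) (V : lmodType k) (c : k) (f : nat -> V)
    (s : nat) : V :=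
  \sum_(r < s.+1) ('C(s.-1, s - r)%:R * c ^+ (s - r)) *: f r.

Variant BDtype := typeB | typeD.

Definition dimN (ty : BDtype) (n : nat) : nat :=
  match ty with typeB => n.*2.+1 | typeD => n.*2 end.

Definition valid_rank (ty : BDtype) (n : nat) : bool :=
  match ty with typeB => 1 <= n | typeD => 2 <= n end%N.

(* Indices are shifted by one: [i : 'I_n] stands for i + 1 in {1, ..., n}. *)
Section RootData.
Variables (ty : BDtype) (n : nat).
Implicit Types i j : 'I_n.

(* coordinates in the basis epsilon_1, ..., epsilon_n *)
Definition simple_root i : 'rV[int]_n :=
  \row_(l < n)
    if (i.+1 < n)%N then (l == i)%:R - (l == i.+1 :> nat)%:R
    else match ty with
         | typeB => (l == i)%:R
         | typeD => (l == i.-1 :> nat)%:R + (l == i)%:R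
         end.

Definition form (x y : 'rV[int]_n) : int := \sum_l x 0 l * y 0 l.

Definition cartan i j : int :=
  match ty with
  | typeD => form (simple_root i) (simple_root j)
  | typeB => if (i.+1 < n)%N then form (simple_root i) (simple_root j)
             else 2 * form (simple_root i) (simple_root j)
  end.

Lemma root_col_subproof i :
  ((if ty is typeD then if (i.+1 < n)%N then i : nat else i.-1 else i)
   < dimN ty n)%N.
Proof.
have lt_in : (i < n.*2)%N.
  by rewrite (leq_trans (ltn_ord i)) // -addnn leq_addr.
case: ty => /=; first exact: ltnW.
by case: ifP => // _; apply: leq_ltn_trans lt_in; apply: leq_pred.
Qed.

Lemma root_row_subproof i : (i.+1 < dimN ty n)%N.
Proof.
have n_gt0 : (0 < n)%N by apply: leq_ltn_trans (ltn_ord i).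
have lt_in : (i.+1 < n.*2)%N.
  by apply: leq_ltn_trans (ltn_ord i) _; rewrite -addnn -{1}[n]addn0 ltn_add2l.
by case: ty => //=; apply: ltnW.
Qed.

(* The entries f_{b,a}(u), e_{a,b}(u) attached to the i-th simple root have
   (a, b) = (i, i+1), except (a, b) = (n-1, n+1) for i = n in type D. In all
   cases they are evaluated at u - (a - 1)/2. *)
Definition root_col i : 'I_(dimN ty n) := Ordinal (root_col_subproof i).
Definition root_row i : 'I_(dimN ty n) := Ordinal (root_row_subproof i).

End RootData.

Variant sign := Plus | Minus.

Definition xi_ser (k : closedFieldType) (ty : BDtype) (n : nat) (sg : sign)
    (i : 'I_n) : nat -> yangian k (dimN ty n) :=
  let a := root_col ty i in
  let b := root_row ty i in
  shift ((a : nat)%:R / 2%:R : k)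
    (fun s => match sg with Plus => fser k _ s b a | Minus => eser k _ s a b end).

Definition xi (k : closedFieldType) (ty : BDtype) (n : nat) (sg : sign)
    (i : 'I_n) (r : nat) : yangian k (dimN ty n) := xi_ser k ty sg i r.+1.

Lemma xi_ser0 k ty n sg (i : 'I_n) : xi_ser k ty sg i 0 = 0.
Proof.
have ab : (root_col ty i < root_row ty i)%N.
  case: ty => //=; case: ifP => // _.
  by rewrite ltnS leq_pred.
rewrite /xi_ser /shift big_ord_recl big_ord0 addr0 /= subn0.
have [F0 _ E0] := gauss0 (tser0 k (dimN ty n)) (gaussP k (dimN ty n)).
by case: sg; rewrite ?F0 ?E0 mxE -val_eqE /= ?(ltn_eqF ab) ?(gtn_eqF ab) scaler0.
Qed.

Definition lie (A : nzRingType) (x y : A) : A := x * y - y * x.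

(* [x_0, [x_1, ... [x_(m-1), y] ... ]] *)
Definition nested_comm (A : nzRingType) (m : nat) (x : 'I_m -> A) (y : A) : A :=
  foldr (fun l z => lie (x l) z) y (enum 'I_m).

(* Main.v *)
(* Idea. Only the entries t_{i,j}(u) with i in the first rows (i <= n for B_n,
   i < n for D_n) and j <= n + 1 matter for the e_{i,i+1}; there, except for a
   pair of columns exchanged by ', the relation is that of the Yangian of gl.
   Writing T = F H E and splitting off one pivot at a time (Schur complements),
   one gets the adjoint action of the Cartan series H_a(u) on the xi_i^-(v): it
   sends the mode x_b to x_b - g (sum_a u^(-a-1) x_(a+b)) with g in {0, 1, -1}.
   Conjugating a Serre sum that vanishes in low degree by H_a(u) and taking
   leading coefficients, as in Levendorskii's argument, propagates the vanishing
   from degree 0, where it is a computation in o_N; one divides only by integers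
   <= 3. For the two end nodes of D_n, which see the same Cartan series, degree 1
   is also needed, and follows from the isotropy of the rows of T(u). The xi^+
   are obtained by transposition in the converse ring. *)

From HB Require Import structures.
From Stdlib Require Import Ncring Ncring_tac.
Require Import Defs.
From mathcomp Require Import all_boot all_order all_algebra all_fingroup.
From mathcomp Require Import zify boolp.

Set Implicit Arguments.
Unset Strict Implicit.
Unset Printing Implicit Defensive.

Import GRing.Theory.
Local Open Scope ring_scope.

(** What separates these relations from those of gl is the trace term. Write R for the number of
    rows in use and C for the number of columns: if R + C <= N, the trace term is absent between
    entries of these rows, unless both columns lie beyond the first R. The elimination only ever
    needs pairs of columns of which one is among the first R, because each pivot is, and this
    property survives replacing a column by a pivot.

    Nothing is inverted. Identities in u and v are multiplied by d = v^-1 - u^-1, which is regular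
    but not invertible among series in u^-1 and v^-1, and H_a(u) is cancelled because its constant
    term is 1.

    The bound p > 3 comes from the symmetry of a Serre sum: the leading-term identity produces up to
    k <= 3 equal copies of one sum. The arguments u - (a - 1)/2 only mix a mode with lower modes of
    the same series, so by multilinearity the relations for the unshifted series are enough. *)

Section NcRing.
Variable B : nzRingType.

(** Gives every [nzRingType] access to the noncommutative ring tactic, with Leibniz equality. The
    tactic does not know which elements are central; these are moved by explicit rewriting. *)
#[export] Instance nzring_ops :
  @Ring_ops B 0 1 +%R *%R (fun x y => x - y) -%R eq := {}.

#[export] Instance nzring_ring : Ring (Ro := nzring_ops).
Proof.
split; try exact: eq_equivalence;
  try (by move=> ? ? -> ? ? ->); try (by move=> ? ? ->).
- exact: add0r.
- exact: addrC.
- exact: addrA.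
- exact: mul1r.
- exact: mulr1.
- exact: mulrA.
- exact: mulrDl.
- by move=> x y z; exact: mulrDr.
- by [].
- exact: addrN.
Qed.

End NcRing.

Ltac ncring := non_commutative_ring.

(* Formal power series in one central variable; for a series in u^-1 the n-th
   value is the coefficient of u^-n. *)
Definition fps (A : Type) : Type := nat -> A.

Section Fps.
Variable A : nzRingType.
Implicit Types f g h : fps A.

HB.instance Definition _ := gen_eqMixin (fps A).
HB.instance Definition _ := gen_choiceMixin (fps A).

Definition fps_add f g : fps A := fun n => f n + g n.
Definition fps_opp f : fps A := fun n => - f n.
Definition fps_const (a : A) : fps A := fun n => if n is 0%N then a else 0.
Definition fps_mul f g : fps A := fun n => \sum_(i < n.+1) f i * g (n - i)%N.

Let fps_addA : associative fps_add.
Proof. by move=> f g h; apply: funext => n; apply: addrA. Qed.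
Let fps_addC : commutative fps_add.
Proof. by move=> f g; apply: funext => n; apply: addrC. Qed.
Let fps_add0 : left_id (fun=> 0) fps_add.
Proof. by move=> f; apply: funext => n; apply: add0r. Qed.
Let fps_addN : left_inverse (fun=> 0) fps_opp fps_add.
Proof. by move=> f; apply: funext => n; apply: addNr. Qed.

HB.instance Definition _ :=
  GRing.isZmodule.Build (fps A) fps_addA fps_addC fps_add0 fps_addN.

(** Up to order m a product only sees truncations, so associativity is inherited from
    polynomials. *)
Let fps_mul_trunc f g m n : (n <= m)%N ->
  fps_mul f g n = ((\poly_(i < m.+1) f i) * (\poly_(i < m.+1) g i))`_n.
Proof.
move=> le_nm; rewrite coefM; apply: eq_bigr => i _.
have le_im : (i <= m)%N by apply: leq_trans le_nm; rewrite -ltnS.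
by rewrite !coef_poly !ltnS le_im (leq_trans (leq_subr _ _)).
Qed.

Let fps_mulA : associative fps_mul.
Proof.
move=> f g h; apply: funext => n.
pose tr (f : fps A) := \poly_(i < n.+1) f i.
have trM f1 g1 m : (m <= n)%N -> (tr (fps_mul f1 g1))`_m = (tr f1 * tr g1)`_m.
  by move=> le_mn; rewrite coef_poly ltnS le_mn -fps_mul_trunc.
rewrite (fps_mul_trunc _ _ (leqnn n)) [RHS](fps_mul_trunc _ _ (leqnn n)).
rewrite -!/(tr _); transitivity (tr f * (tr g * tr h))`_n.
  by rewrite !coefM; apply: eq_bigr => i _; rewrite trM ?leq_subr.
rewrite mulrA [LHS]coefM [RHS]coefM; apply: eq_bigr => i _; rewrite trM //.
by rewrite -ltnS.
Qed.

Let fps_mul1 : left_id (fps_const 1) fps_mul.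
Proof.
move=> f; apply: funext => n; rewrite /fps_mul big_ord_recl big1 ?addr0.
  by rewrite mul1r subn0.
by move=> i _; rewrite mul0r.
Qed.

Let fps_mulr1 : right_id (fps_const 1) fps_mul.
Proof.
move=> f; apply: funext => n; rewrite /fps_mul big_ord_recr big1 => [|i _].
  by rewrite /= add0r subnn mulr1.
by have := ltn_ord i; rewrite -subn_gt0 /=; case: (n - i)%N => // m; rewrite mulr0.
Qed.

Let fps_mulDl : left_distributive fps_mul +%R.
Proof.
move=> f g h; apply: funext => n; rewrite /fps_mul -[RHS]big_split.
by apply: eq_bigr => i _; apply: mulrDl.
Qed.

Let fps_mulDr : right_distributive fps_mul +%R.
Proof.
move=> f g h; apply: funext => n; rewrite /fps_mul -[RHS]big_split.
by apply: eq_bigr => i _; apply: mulrDr.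
Qed.

Let fps_one_neq0 : fps_const 1 != 0.
Proof.
apply/eqP => /(congr1 (@^~ 0)) /eqP; exact/negP/oner_neq0.
Qed.

HB.instance Definition _ := GRing.Zmodule_isNzRing.Build (fps A)
  fps_mulA fps_mul1 fps_mulr1 fps_mulDl fps_mulDr fps_one_neq0.

Lemma fpsP f g : (forall n, f n = g n) -> f = g.
Proof. exact: funext. Qed.

Lemma fpsDE f g n : (f + g) n = f n + g n. Proof. by []. Qed.
Lemma fpsNE f n : (- f) n = - f n. Proof. by []. Qed.
Lemma fpsBE f g n : (f - g) n = f n - g n. Proof. by []. Qed.
Lemma fps0E n : (0 : fps A) n = 0. Proof. by []. Qed.
Lemma fpsME f g n : (f * g) n = \sum_(i < n.+1) f i * g (n - i)%N.
Proof. by []. Qed.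
Lemma fps1E n : (1 : fps A) n = (n == 0)%:R. Proof. by case: n. Qed.

Lemma fpsMnE f m n : (f *+ m) n = f n *+ m.
Proof. by elim: m => [|m IH] //; rewrite !mulrS fpsDE IH. Qed.
Lemma fpsMzE f (m : int) n : (f *~ m) n = f n *~ m.
Proof. by case: m => m; rewrite ?NegzE ?mulrNz ?fpsNE -!pmulrn fpsMnE. Qed.

Lemma fps_sumE (I : Type) (r : seq I) (P : pred I) (F : I -> fps A) n :
  (\sum_(i <- r | P i) F i) n = \sum_(i <- r | P i) F i n.
Proof. by elim/big_rec2: _ => //= i y1 y2 _ <-. Qed.

Lemma fps_constME (a : A) f n : (fps_const a * f) n = a * f n.
Proof.
rewrite fpsME big_ord_recl subn0 big1 ?addr0 // => i _.
by rewrite mul0r.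
Qed.

Lemma fps_Mconst (a : A) f n : (f * fps_const a) n = f n * a.
Proof.
rewrite fpsME big_ord_recr big1 => [|i _]; first by rewrite /= add0r subnn.
by have := ltn_ord i; rewrite -subn_gt0 /=; case: (n - i)%N => // m; rewrite mulr0.
Qed.

Definition fpsX : fps A := fun n => (n == 1)%:R.

Lemma fpsXM f n : (fpsX * f) n = if n is m.+1 then f m else 0.
Proof.
rewrite fpsME; case: n => [|n]; first by rewrite big_ord1 mul0r.
rewrite big_ord_recl mul0r add0r big_ord_recl mul1r /= subSS subn0.
by rewrite big1 ?addr0 // => i _; rewrite mul0r.
Qed.

Lemma fpsMX f n : (f * fpsX) n = if n is m.+1 then f m else 0.
Proof.
rewrite fpsME; case: n => [|n]; first by rewrite big_ord1 mulr0.
rewrite big_ord_recr /= subnn mulr0 addr0 big_ord_recr /= subSnn mulr1.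
rewrite big1 ?add0r // => i _; rewrite /fpsX /= subSn 1?ltnW // eqSS subn_eq0.
by rewrite leqNgt ltn_ord mulr0.
Qed.

Lemma fpsXC f : fpsX * f = f * fpsX.
Proof. by apply: fpsP => n; rewrite fpsXM fpsMX. Qed.

Lemma fps_lreg h : h 0%N = 1 -> GRing.lreg h.
Proof.
move=> h0; apply: mulrI0_lreg => f e; apply: fpsP => n.
elim/ltn_ind: n => n IH; have := congr1 (@^~ n) e.
rewrite fpsME big_ord_recl h0 mul1r subn0 big1 ?addr0 // => i _.
rewrite IH ?mulr0 //=.
rewrite /bump add1n; case: n {IH} i => [[]|n i] //; rewrite subSS ltnS leq_subr //.
Qed.

Lemma fps_rreg h : h 0%N = 1 -> GRing.rreg h.
Proof.
move=> h0; apply: mulIr0_rreg => f e; apply: fpsP => n.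
elim/ltn_ind: n => n IH; have := congr1 (@^~ n) e.
rewrite fpsME big_ord_recr /= subnn h0 mulr1 big1 ?add0r // => i _.
by rewrite IH ?mul0r.
Qed.

End Fps.

(** * Gauss decomposition and relations of gl type *)

Section GaussStep.
Variables (B : nzRingType) (I : Type) (d c : B).
Hypothesis dC : forall z, d * z = z * d.
Hypothesis cC : forall z, c * z = z * c.
Hypothesis d_reg : GRing.lreg d.
Hypothesis dc_reg : GRing.lreg (d - c).

Local Notation "'D[' a , b ]" := (d * (a * b - b * a)) (at level 0).

(* With d = v^-1 - u^-1 and c = u^-1 v^-1 this is the relation
   (u - v) [t_ij(u), t_kl(v)] = t_kj(u) t_il(v) - t_kj(v) t_il(u). *)
Definition glrel (t t' : I -> I -> B) i j k l :=
  D[t i j, t' k l] = c * (t k j * t' i l - t' k j * t i l).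

(** One elimination step: t = X + f h e with pivot p, so that X is a Schur complement and f, e are
    the normalized pivot column and row. Primed series live in the second variable. [good] marks the
    pairs of columns for which the relation is available; it has to survive the replacement of
    either column by p. *)
Variables (p : I) (row : I -> Prop) (good : I -> I -> Prop).
Variables (t t' X X' : I -> I -> B) (f f' e e' : I -> B) (h h' : B).
Hypothesis row_p : row p.
Hypothesis good_p : forall j l, good j l -> [/\ good p l, good j p, good p j & good p p].
Hypothesis tE : forall i j, t i j = X i j + f i * h * e j.
Hypothesis tE' : forall i j, t' i j = X' i j + f' i * h' * e' j.
Hypothesis (Xl : forall j, X p j = 0) (Xr : forall i, X i p = 0).
Hypothesis (Xl' : forall j, X' p j = 0) (Xr' : forall i, X' i p = 0).
Hypothesis (fp : f p = 1) (ep : e p = 1) (fp' : f' p = 1) (ep' : e' p = 1).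
Hypothesis (h_l : GRing.lreg h) (h_r : GRing.rreg h) (h_l' : GRing.lreg h').
Hypothesis rel :
  forall i j k l, row i -> row k -> good j l -> glrel t t' i j k l.

Let tpj j : t p j = h * e j. Proof. by rewrite tE Xl fp add0r mul1r. Qed.
Let tip i : t i p = f i * h. Proof. by rewrite tE Xr ep add0r mulr1. Qed.
Let tpj' j : t' p j = h' * e' j. Proof. by rewrite tE' Xl' fp' add0r mul1r. Qed.
Let tip' i : t' i p = f' i * h'. Proof. by rewrite tE' Xr' ep' add0r mulr1. Qed.
Let tpp : t p p = h. Proof. by rewrite tpj ep mulr1. Qed.
Let tpp' : t' p p = h'. Proof. by rewrite tpj' ep' mulr1. Qed.

Let dA z w : z * (d * w) = d * (z * w). Proof. by rewrite mulrA -dC -mulrA. Qed.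
Let cA z w : z * (c * w) = c * (z * w). Proof. by rewrite mulrA -cC -mulrA. Qed.

Lemma gauss_step_tX i j k l : row i -> row k -> good j l ->
  D[t i j, X' k l] = c * ((t k j - f' k * t p j) * X' i l
                          - X' k j * (t i l - t i p * e' l)).
Proof.
move=> ri rk g; have [gpl gjp gpj gpp] := good_p g.
have R1 := rel ri rk g; have R2 := rel ri rk gjp.
have R3 := rel ri row_p g; have R4 := rel ri row_p gjp.
rewrite /glrel !tpp' !tpj' !tip' in R1 R2 R3 R4.
have -> : X' k l = t' k l - f' k * h' * e' l by rewrite tE' addrK.
have -> : X' i l = t' i l - f' i * h' * e' l by rewrite tE' addrK.
have -> : X' k j = t' k j - f' k * h' * e' j by rewrite tE' addrK.
(* The bracket with e' alone is not known, but h' [t, e'] = [t, h' e'] - [t, h'] e', and f' h', h'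
   e', h' are entries of t' in row or column p. *)
transitivity (D[t i j, t' k l] - D[t i j, (f' k * h')] * e' l
  - (d * f' k) * (t i j * (h' * e' l) - h' * e' l * t i j)
  + (d * f' k) * (t i j * h' - h' * t i j) * e' l); first by ncring.
rewrite [d * f' k]dC -[f' k * d * _]mulrA -[f' k * d * _]mulrA R1 R2 R3 R4.
rewrite [f' k * (c * _)]mulrA -[f' k * c]cC -[c * f' k * _]mulrA.
rewrite [f' k * (c * _)]mulrA -[f' k * c]cC.
by ncring.
Qed.

(** For i = j = p each term on the right of [gauss_step_tX] contains an entry of X' in row or column
    p, hence vanishes. *)
Lemma gauss_step_hX k l : row k -> good p l -> h * X' k l = X' k l * h.
Proof.
move=> rk g; have := gauss_step_tX row_p rk g.
rewrite Xl' Xr' mulr0 mul0r subrr mulr0 tpp => /eqP.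
by rewrite mulrI_eq0 // subr_eq0 => /eqP.
Qed.

Lemma gauss_step_eX j k l : row k -> good j l ->
  D[e j, X' k l] = c * (X' k j * (e' l - e l)).
Proof.
move=> rk g; have [gpl gjp gpj gpp] := good_p g.
apply: h_l; have := gauss_step_tX row_p rk g.
rewrite Xl' mulr0 tpp !tpj sub0r => e1.
have hx := gauss_step_hX rk gpl; have hxj := gauss_step_hX rk gpj.
transitivity (D[h * e j, X' k l] + d * (X' k l * h - h * X' k l) * e j).
  by rewrite mulrA -dC; ncring.
rewrite e1 hx subrr mulr0 mul0r addr0 mulrA -cC -mulrA.
by congr (c * _); rewrite mulrA hxj; ncring.
Qed.

Lemma gauss_step_fX i k l : row i -> row k -> good p l ->
  D[f i, X' k l] = c * ((f k - f' k) * X' i l).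
Proof.
move=> ri rk g; apply: h_r; have := gauss_step_tX ri rk g.
rewrite Xr' mul0r subr0 tpp !tip => e1.
have hx := gauss_step_hX rk g; have hxi := gauss_step_hX ri g.
transitivity (D[f i * h, X' k l] + d * f i * (X' k l * h - h * X' k l)).
  by ncring.
rewrite e1 hx subrr mulr0 addr0 -mulrA.
by congr (c * _); rewrite -[RHS]mulrA -hxi; ncring.
Qed.

Lemma gauss_step_X i j k l : row i -> row k -> good j l -> glrel X X' i j k l.
Proof.
move=> ri rk g; have [gpl gjp gpj gpp] := good_p g.
apply/eqP; rewrite -subr_eq0 -(mulrI_eq0 _ d_reg); apply/eqP.
have e1 := gauss_step_tX ri rk g; have eX1 := gauss_step_eX rk g.
have eX2 := gauss_step_eX ri g; have fX1 := gauss_step_fX ri rk gpl.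
have fX2 := gauss_step_fX ri rk gpj.
have hx := gauss_step_hX rk gpl; have hxj := gauss_step_hX rk gpj.
have hxi := gauss_step_hX ri gpl.
(* The error term is a combination of the commutators of e_j with X'_il and of
   f_i with X'_kj, which cancel once multiplied by d. *)
have key : D[X i j, X' k l] - c * (X k j * X' i l - X' k j * X i l)
  = c * ((f k - f' k) * (h * e j * X' i l - X' i l * (h * e j)))
    + c * ((f i * X' k j - X' k j * f i) * (h * (e l - e' l))).
  have -> : D[X i j, X' k l] = D[t i j, X' k l]
      - (D[f i, X' k l] * (h * e j) + f i * (d * (h * e j * X' k l - X' k l * h * e j))).
    by rewrite tE dA; ncring.
  rewrite e1 fX1 -hx.
  have -> : d * (h * e j * X' k l - h * X' k l * e j) = h * D[e j, X' k l].
    by rewrite dA; ncring.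
  rewrite eX1 !tE Xl Xr fp ep.
  rewrite !cA [h * (X' k j * _)]mulrA hxj.
  by ncring.
rewrite key mulrDr !cA -mulrDr.
have -> : d * ((f k - f' k) * (h * e j * X' i l - X' i l * (h * e j)))
   = (f k - f' k) * (h * D[e j, X' i l]).
  by rewrite !dA [X' i l * (h * e j)]mulrA -hxi; ncring.
have -> : d * ((f i * X' k j - X' k j * f i) * (h * (e l - e' l)))
   = D[f i, X' k j] * (h * (e l - e' l)) by rewrite !mulrA.
rewrite eX2 fX2.
have hxij := gauss_step_hX ri gpj.
rewrite ![h * (c * _)]cA [h * (X' i j * _)]mulrA hxij ![_ * (c * _)]cA.
rewrite -[c * _ * _]mulrA -mulrDr.
set Z := (Z in c * (c * Z)); suff -> : Z = 0 by rewrite !mulr0.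
by rewrite /Z; ncring.
Qed.

(** The relation at the pivot entry itself reads (d - c) [h, h'] = 0, that is (u - v - 1)
    [h(u), h(v)] = 0. This is where regularity of d - c enters; once h and h' commute, e' is
    isolated from h' e'. *)
Lemma gauss_step_he j : good p j -> D[h, e' j] = c * (h * (e' j - e j)).
Proof.
move=> g; have [_ _ _ gpp] := good_p g; apply: h_l'.
have R1 := rel row_p row_p g; have R2 := rel row_p row_p gpp.
rewrite /glrel !tpp !tpp' in R1 R2; rewrite !tpj !tpj' in R1.
have hh : h * h' - h' * h = 0.
  apply: dc_reg; rewrite mulr0 mulrBl R2 subrr //.
have hh' : h * h' = h' * h by apply/eqP; rewrite -subr_eq0 hh.
transitivity (D[h, (h' * e' j)] - D[h, h'] * e' j).
  by rewrite mulrA -dC; ncring.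
rewrite R1 hh mulr0 mul0r subr0 [RHS]mulrA -cC -mulrA; congr (c * _).
by rewrite mulrA hh'; ncring.
Qed.

End GaussStep.

Section GaussTail.
Variables (B : nzRingType) (N : nat).
Implicit Types (F E : 'I_N -> 'I_N -> B) (H : 'I_N -> B) (i j m p : 'I_N).

Record unitri_gauss F H E : Prop := UnitriGauss {
  ug_F1 : forall i, F i i = 1;
  ug_F0 : forall i j, (i < j)%N -> F i j = 0;
  ug_E1 : forall i, E i i = 1;
  ug_E0 : forall i j, (j < i)%N -> E i j = 0;
  ug_Hl : forall i, GRing.lreg (H i);
  ug_Hr : forall i, GRing.rreg (H i) }.

(* Iterated Schur complements of the matrix F H E. *)
Definition gauss_tail F H E (a : nat) i j : B :=
  \sum_(m < N | (a <= m)%N) F i m * H m * E m j.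

Lemma gauss_tail_step F H E p i j :
  gauss_tail F H E p i j = gauss_tail F H E p.+1 i j + F i p * H p * E p j.
Proof.
rewrite /gauss_tail (bigD1 p) //= addrC; congr (_ + _); apply: eq_bigl => m.
by rewrite andbC -val_eqE /= eq_sym -ltn_neqAle.
Qed.

Lemma gauss_tail_row0 F H E p j : unitri_gauss F H E ->
  gauss_tail F H E p.+1 p j = 0.
Proof. by move=> g; apply: big1 => m pm; rewrite (ug_F0 g) // !mul0r. Qed.

Lemma gauss_tail_col0 F H E p i : unitri_gauss F H E ->
  gauss_tail F H E p.+1 i p = 0.
Proof. by move=> g; apply: big1 => m pm; rewrite (ug_E0 g) // mulr0. Qed.

Lemma gauss_tail_row F H E p j : unitri_gauss F H E ->
  gauss_tail F H E p p j = H p * E p j.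
Proof.
by move=> g; rewrite gauss_tail_step gauss_tail_row0 // (ug_F1 g) mul1r add0r.
Qed.

Lemma gauss_tail_col F H E p i : unitri_gauss F H E ->
  gauss_tail F H E p i p = F i p * H p.
Proof.
by move=> g; rewrite gauss_tail_step gauss_tail_col0 // (ug_E1 g) mulr1 add0r.
Qed.

End GaussTail.

Section GaussRelations.
Variables (B : nzRingType) (N R C : nat) (d c : B).
Hypothesis dC : forall z, d * z = z * d.
Hypothesis cC : forall z, c * z = z * c.
Hypothesis d_reg : GRing.lreg d.
Hypothesis dc_reg : GRing.lreg (d - c).
Variables (F E F' E' : 'I_N -> 'I_N -> B) (H H' : 'I_N -> B).
Hypothesis (le_RC : (R <= C)%N) (le_CN : (C <= N)%N).
Hypothesis (ug : unitri_gauss F H E) (ug' : unitri_gauss F' H' E').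

Local Notation T := (gauss_tail F H E).
Local Notation T' := (gauss_tail F' H' E').
Local Notation "'D[' a , b ]" := (d * (a * b - b * a)) (at level 0).

Definition gl_row (a : nat) (i : 'I_N) : Prop := (a <= i < R)%N.
(** The last condition discards pairs of columns both beyond [R], the only pairs below [C] that '
    can exchange when R + C <= N. *)
Definition gl_cols (a : nat) (j l : 'I_N) : Prop :=
  [&& a <= j < C, a <= l < C & (j < R) || (l < R)]%N.

Hypothesis rel0 : forall i j k l, gl_row 0 i -> gl_row 0 k -> gl_cols 0 j l ->
  glrel d c (T 0%N) (T' 0%N) i j k l.

Let gl_colsp (p : 'I_N) : (p < R)%N -> forall j l, gl_cols p j l ->
  [/\ gl_cols p p l, gl_cols p j p, gl_cols p p j & gl_cols p p p].
Proof.
move=> pR j l /and3P[j1 l1 _]; have pC := leq_trans pR le_RC.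
by split; apply/and3P; split=> //; rewrite ?leqnn ?pC ?pR ?orbT.
Qed.

Ltac pivot_hyps p := first
  [ exact: gl_colsp | exact: gauss_tail_step
  | by move=> ?; apply: (gauss_tail_row0 p _ ug)
  | by move=> ?; apply: (gauss_tail_col0 p _ ug)
  | by move=> ?; apply: (gauss_tail_row0 p _ ug')
  | by move=> ?; apply: (gauss_tail_col0 p _ ug')
  | exact: ug_F1 ug _ | exact: ug_E1 ug _ | exact: ug_F1 ug' _
  | exact: ug_E1 ug' _ | exact: ug_Hl ug _ | exact: ug_Hr ug _
  | exact: ug_Hl ug' _ | idtac ].

Lemma gauss_tail_rel (a : nat) i j k l : (a <= R)%N ->
  gl_row a i -> gl_row a k -> gl_cols a j l -> glrel d c (T a) (T' a) i j k l.
Proof.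
elim: a i j k l => [|a IH] i j k l aR; first exact: rel0.
move=> /andP[ai iR] /andP[ak kR] /and3P[/andP[aj jC] /andP[al lC] jl].
have aN : (a < N)%N by rewrite (leq_trans aR) // (leq_trans le_RC).
pose p := Ordinal aN.
apply: (@gauss_step_X B 'I_N d c dC cC d_reg p (gl_row p) (gl_cols p)
  (T p) (T' p) _ _ (F^~ p) (F'^~ p) (E p) (E' p) (H p) (H' p)); try pivot_hyps p.
- by rewrite /gl_row leqnn.
- by move=> i1 j1 k1 l1; apply: IH; rewrite ltnW.
- by rewrite /gl_row /= ltnW.
- by rewrite /gl_row /= ltnW.
- by apply/and3P; split; rewrite /= ?jC ?lC ?andbT // ltnW.
Qed.

Section Pivot.
Variables (p : 'I_N) (pR : (p < R)%N).

Let step (P : Prop) :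
  ((forall i j k l, gl_row p i -> gl_row p k -> gl_cols p j l ->
      glrel d c (T p) (T' p) i j k l) -> P) -> P.
Proof. by apply=> i j k l; apply: gauss_tail_rel; apply: ltnW. Qed.

Let rp : gl_row p p. Proof. by rewrite /gl_row leqnn. Qed.

Lemma pivotH_tailC (k l : 'I_N) : gl_row p k -> (p <= l < C)%N ->
  H p * T' p.+1 k l = T' p.+1 k l * H p.
Proof.
move=> rk lC; apply: (@gauss_step_hX B 'I_N d c dC cC d_reg p (gl_row p)
  (gl_cols p) (T p) (T' p) (T p.+1) _ (F^~ p) (F'^~ p)
  (E p) (E' p) (H p) (H' p)) => //; try pivot_hyps p.
- by apply: step.
- by apply/and3P; split; rewrite ?leqnn ?pR //= (leq_trans pR).
Qed.

Lemma pivotE_tail (j k l : 'I_N) : gl_row p k -> gl_cols p j l ->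
  D[E p j, T' p.+1 k l] = c * (T' p.+1 k j * (E' p l - E p l)).
Proof.
move=> rk g; apply: (@gauss_step_eX B 'I_N d c dC cC d_reg p (gl_row p)
  (gl_cols p) (T p) (T' p) (T p.+1) _ (F^~ p) (F'^~ p)
  (E p) (E' p) (H p) (H' p)) => //; try pivot_hyps p.
- by apply: step.
Qed.

Lemma pivotH_pivotE (j : 'I_N) : (p <= j < C)%N ->
  D[H p, E' p j] = c * (H p * (E' p j - E p j)).
Proof.
move=> jC; apply: (@gauss_step_he B 'I_N d c dC cC dc_reg p (gl_row p)
  (gl_cols p) (T p) (T' p) (T p.+1) (T' p.+1) (F^~ p) (F'^~ p)
  (E p) (E' p) (H p) (H' p)) => //; try pivot_hyps p.
- by apply: step.
- by apply/and3P; split; rewrite ?leqnn ?pR //= (leq_trans pR).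
Qed.

End Pivot.

(** What commutes with a block commutes with its Gauss factors: H_q and H_q E_{q,l} are entries of
    the tail at q, H_q can be cancelled, and the next tail is a polynomial in these. *)
Lemma tail_comm (z : B) (a b : nat) : (a <= b)%N ->
  (forall k l : 'I_N, gl_row a k -> (a <= l < C)%N -> GRing.comm z (T' a k l)) ->
  forall k l : 'I_N, gl_row b k -> (b <= l < C)%N -> GRing.comm z (T' b k l).
Proof.
move=> /subnK <-; elim: (b - a)%N => //= {b} m IH comm k l /andP[mk kR] /andP[ml lC].
rewrite addSn in mk ml *; have {IH} := IH comm.
set b := (m + a)%N in mk ml * => comm1.
have bN : (b < N)%N by apply: ltn_trans (ltn_ord k).
pose q := Ordinal bN.
have bR : (b < R)%N by apply: leq_trans kR; apply: ltnW.
have bC : (b < C)%N by apply: leq_trans le_RC.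
have rq : gl_row b q by rewrite /gl_row /= leqnn.
have zH : GRing.comm z (H' q).
  rewrite -[H' q]mulr1 -(ug_E1 ug' q) -(gauss_tail_row q q ug').
  by apply: comm1; rewrite ?leqnn.
have zE : GRing.comm z (E' q l).
  apply: (ug_Hl ug' (i := q)); rewrite [LHS]mulrA -zH -mulrA -(gauss_tail_row q l ug').
  rewrite comm1 //=; last by rewrite (ltnW ml).
  by rewrite (gauss_tail_row q l ug') mulrA.
have -> : T' b.+1 k l = T' b k l - T' b k q * E' q l.
  by rewrite (gauss_tail_step _ _ _ q) (gauss_tail_col q k ug') addrK.
apply: commrB; first by apply: comm1; rewrite ?/gl_row ?(ltnW mk) // (ltnW ml).
by apply: commrM => //; apply: comm1; rewrite ?/gl_row ?(ltnW mk) //= leqnn.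
Qed.

Lemma tail_commHE (z : B) (a : nat) (q j : 'I_N) :
  (a <= q < R)%N -> (q <= j < C)%N ->
  (forall k l : 'I_N, gl_row a k -> (a <= l < C)%N -> GRing.comm z (T' a k l)) ->
  GRing.comm z (H' q) /\ GRing.comm z (E' q j).
Proof.
move=> /andP[aq qR] qj comm; have {}comm := tail_comm aq comm.
have rq : gl_row q q by rewrite /gl_row leqnn.
have zH : GRing.comm z (H' q).
  rewrite -[H' q]mulr1 -(ug_E1 ug' q) -(gauss_tail_row q q ug').
  by apply: comm; rewrite ?leqnn //= (leq_trans qR).
split=> //; apply: (ug_Hl ug' (i := q)).
rewrite [LHS]mulrA -zH -mulrA -(gauss_tail_row q j ug').
by rewrite comm //= gauss_tail_row // mulrA.
Qed.

Lemma pivotH_E_gt (p q j : 'I_N) : (p < q < R)%N -> (q <= j < C)%N ->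
  GRing.comm (H p) (E' q j).
Proof.
move=> /andP[pq qR] qj; apply: (@tail_commHE _ p.+1 q j _ qj _).2.
  by rewrite pq.
move=> k l /andP[pk kR] /andP[pl lC]; apply: pivotH_tailC.
- exact: ltn_trans qR.
- by rewrite /gl_row (ltnW pk).
- by rewrite (ltnW pl).
Qed.

(** For q = p + 1 the pivot H_q is the corner entry of the tail that remains after p, so
    [pivotE_tail] applies with all indices equal to q. *)
Lemma pivotE_H_next (p q : 'I_N) : (q = p.+1 :> nat) -> (q < R)%N ->
  D[E p q, H' q] = c * (H' q * (E' p q - E p q)).
Proof.
move=> qp qR; rewrite -[H' q]mulr1 -(ug_E1 ug' q) -(gauss_tail_row q q ug') qp.
have pR : (p < R)%N by rewrite (leq_trans _ qR) // qp leqnSn.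
apply: pivotE_tail => //; rewrite /gl_row /gl_cols !qR ?orbT qp leqnSn //=.
by rewrite -qp (leq_trans qR).
Qed.

(** Bracketing the tail at q with E_{p,q} replaces each column l by a right multiple of column q.
    Such a column operation does not affect the Schur complement at (q, q), so E_{p,q} commutes with
    the tail at q + 1 and with all later pivots. *)
Lemma pivotE_H_gt (p q r : 'I_N) : (q = p.+1 :> nat) -> (q < r < R)%N ->
  GRing.comm (E p q) (H' r).
Proof.
move=> qp /andP[qr rR].
have qR := ltn_trans qr rR; have qC := leq_trans qR le_RC.
have rC := leq_trans rR le_RC.
have pR : (p < R)%N by rewrite (leq_trans _ qR) // qp leqnSn.
have rq : gl_row p q by rewrite /gl_row qp leqnSn -qp.
have pqE (k l : 'I_N) : gl_row p.+1 k -> (p.+1 <= l < C)%N ->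
    D[E p q, T' q k l] = c * (T' q k q * (E' p l - E p l)).
  move=> /andP[pk kR] /andP[pl lC]; rewrite qp; apply: pivotE_tail => //.
    by rewrite /gl_row (ltnW pk).
  by rewrite /gl_cols qR qC lC qp leqnSn (ltnW pl).
have rqq : gl_row p.+1 q by rewrite /gl_row -qp leqnn.
apply: (@tail_commHE _ q.+1 r r _ _ _).1; rewrite ?leqnn ?qr //.
move=> k l /andP[qk kR] /andP[ql lC].
apply/eqP; rewrite -subr_eq0 -(mulrI_eq0 _ d_reg); apply/eqP.
have rk : gl_row p.+1 k by rewrite /gl_row -qp (ltnW qk).
have lq : (p.+1 <= l < C)%N by rewrite -qp (ltnW ql).
have qq : (p.+1 <= q < C)%N by rewrite -qp leqnn.
have -> : T' q.+1 k l = T' q k l - T' q k q * E' q l.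
  by rewrite (gauss_tail_step _ _ _ q) (gauss_tail_col q k ug') addrK.
have e1 := pqE k l rk lq; have e2 := pqE k q rk qq.
have e3 := pqE q l rqq lq; have e4 := pqE q q rqq qq.
rewrite !(gauss_tail_row q _ ug') (ug_E1 ug') !mulr1 in e3 e4.
have e5 : D[E p q, E' q l]
    = c * ((E' p l - E p l) - (E' p q - E p q) * E' q l).
  apply: (ug_Hl ug' (i := q)).
  transitivity (D[E p q, (H' q * E' q l)] - D[E p q, H' q] * E' q l).
    by rewrite mulrA -dC; ncring.
  by rewrite e3 e4 [RHS]mulrA -cC; ncring.
transitivity (D[E p q, T' q k l] - D[E p q, T' q k q] * E' q l
    - T' q k q * D[E p q, E' q l]).
  by rewrite [T' q k q * (d * _)]mulrA -[T' q k q * d]dC; ncring.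
rewrite e1 e2 e5 [T' q k q * (c * _)]mulrA -[T' q k q * c]cC.
by ncring.
Qed.

End GaussRelations.

(** * Series in two variables *)

(* In [fps (fps A)] the inner variable is u^-1 and the outer one is v^-1. *)
Section TwoVariables.
Variable A : nzRingType.
Implicit Types (f g h : fps A).
Local Notation B := (fps (fps A)).

Definition in_u f : B := fps_const f.
Definition in_v f : B := fun s => fps_const (f s).
Definition uinv : B := fps_const (fpsX A).
Definition vinv : B := fpsX (fps A).

Lemma fps_constM (R : nzRingType) (a b : R) :
  fps_const (a * b) = fps_const a * fps_const b.
Proof. by apply: fpsP => n; rewrite fps_constME; case: n => //= n; rewrite mulr0. Qed.

Lemma fps_const_sum (R : nzRingType) (I : Type) (r : seq I) (P : pred I) (G : I -> R) :
  fps_const (\sum_(i <- r | P i) G i) = \sum_(i <- r | P i) fps_const (G i).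
Proof.
apply: fpsP => n; rewrite fps_sumE; case: n => //= n.
by rewrite big1.
Qed.

Lemma in_uM f g : in_u (f * g) = in_u f * in_u g.
Proof. exact: fps_constM. Qed.

Lemma in_vM f g : in_v (f * g) = in_v f * in_v g.
Proof.
apply: fpsP => s; rewrite fpsME /in_v fpsME fps_const_sum.
by apply: eq_bigr => i _; rewrite fps_constM.
Qed.

Lemma in_u_sum (I : Type) (r : seq I) (P : pred I) (G : I -> fps A) :
  in_u (\sum_(i <- r | P i) G i) = \sum_(i <- r | P i) in_u (G i).
Proof. exact: fps_const_sum. Qed.

Lemma in_v_sum (I : Type) (r : seq I) (P : pred I) (G : I -> fps A) :
  in_v (\sum_(i <- r | P i) G i) = \sum_(i <- r | P i) in_v (G i).
Proof.
by apply: fpsP => s; rewrite fps_sumE /in_v fps_sumE fps_const_sum.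
Qed.

Lemma in_u1 : in_u 1 = 1. Proof. by []. Qed.
Lemma in_v1 : in_v 1 = 1.
Proof. by apply: fpsP => -[|n] //; apply: fpsP => -[|r]. Qed.
Lemma in_u0 : in_u 0 = 0.
Proof. by apply: fpsP => -[|n]. Qed.
Lemma in_v0 : in_v 0 = 0.
Proof. by apply: fpsP => n; apply: fpsP => -[|r]. Qed.

Lemma in_uvME f g s r : (in_u f * in_v g) s r = f r * g s.
Proof. by rewrite fps_constME fps_Mconst. Qed.

Lemma in_vuME f g s r : (in_v g * in_u f) s r = g s * f r.
Proof. by rewrite fps_Mconst fps_constME. Qed.

Lemma in_u_lreg h : h 0%N = 1 -> GRing.lreg (in_u h).
Proof.
move=> h0 f g e; apply: fpsP => s; apply: (fps_lreg h0).
by have := congr1 (@^~ s) e; rewrite /in_u !fps_constME.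
Qed.

Lemma in_u_rreg h : h 0%N = 1 -> GRing.rreg (in_u h).
Proof.
move=> h0 f g e; apply: fpsP => s; apply: (fps_rreg h0).
by have := congr1 (@^~ s) e; rewrite /in_u !fps_Mconst.
Qed.

Lemma in_v_lreg h : h 0%N = 1 -> GRing.lreg (in_v h).
Proof. by move=> h0; apply: fps_lreg; rewrite /in_v h0. Qed.

Lemma in_v_rreg h : h 0%N = 1 -> GRing.rreg (in_v h).
Proof. by move=> h0; apply: fps_rreg; rewrite /in_v h0. Qed.

Lemma uinvC (z : B) : uinv * z = z * uinv.
Proof. by apply: fpsP => s; rewrite fps_constME fps_Mconst fpsXC. Qed.

Lemma vinvC (z : B) : vinv * z = z * vinv.
Proof. exact: fpsXC. Qed.

Lemma uinvME (z : B) s r : (uinv * z) s r = if r is r'.+1 then z s r' else 0.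
Proof. by rewrite fps_constME fpsXM. Qed.

Lemma vinvME (z : B) s r : (vinv * z) s r = if s is s'.+1 then z s' r else 0.
Proof. by rewrite fpsXM; case: s. Qed.

(** If v^-1 a(u) z = u^-1 z, the coefficients of z vanish by induction on the power of v^-1. The
    cases a = 1 and a = 1 - u^-1 give [uv_d] and [uv_d - uv_c]. *)
Lemma vinv_uinv_lreg (a : fps A) : GRing.lreg (vinv * in_u a - uinv).
Proof.
apply: mulrI0_lreg => z; rewrite mulrBl -mulrA => /eqP.
rewrite subr_eq0 => /eqP e.
have z0 s : (forall s', (s' < s)%N -> z s' = 0) -> z s = 0.
  move=> IH; apply: fpsP => r; have := congr1 (fun w : B => w s r.+1) e.
  rewrite uinvME vinvME => <-; case: s IH => // s IH.
  by rewrite fps_constME IH ?mulr0.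
apply: fpsP => s; elim/ltn_ind: s => s IH; exact: z0.
Qed.

Definition uv_d : B := vinv - uinv.
Definition uv_c : B := uinv * vinv.

Lemma uv_dC z : uv_d * z = z * uv_d.
Proof. by rewrite mulrBl mulrBr uinvC vinvC. Qed.

Lemma uv_cC z : uv_c * z = z * uv_c.
Proof. by rewrite -mulrA vinvC mulrA uinvC mulrA. Qed.

Lemma uv_d_reg : GRing.lreg uv_d.
Proof. by have := @vinv_uinv_lreg 1; rewrite in_u1 mulr1. Qed.

Lemma uv_dc_reg : GRing.lreg (uv_d - uv_c).
Proof.
have := @vinv_uinv_lreg (1 - fpsX A).
rewrite (_ : vinv * _ - _ = uv_d - uv_c) //.
have -> : in_u (1 - fpsX A) = 1 - uinv.
  by apply: fpsP => -[|n] //=; rewrite fpsBE /= subrr.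
by rewrite /uv_d /uv_c uinvC; ncring.
Qed.

Lemma uv_Nd_reg : GRing.lreg (- uv_d).
Proof. by apply/lregN/uv_d_reg. Qed.

(** The series h(u)^-1 x_b h(u) when the modes x_b of e have weight g under h. The mode x_b is the
    coefficient [e b.+1]. *)
Definition shifted (g : int) (e : fps A) (b : nat) : fps A :=
  fun a => if a is a'.+1 then - (e (a' + b).+1 *~ g) else e b.+1.

(* Dividing by u - v: (u - v) sum_(a, b) e_(a+b) u^-a-1 v^-b-1 = e(v) - e(u). *)
Lemma intertwine (h e : fps A) (g : int) :
  uv_d * (in_u h * in_v e - in_v e * in_u h)
    = (uv_c * (in_u h * (in_v e - in_u e))) *~ g ->
  forall b, fps_const (e b.+1) * h = h * shifted g e b.
Proof.
pose D : B := fun s r => match s, r with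
  | s'.+1, r'.+1 => e (r' + s').+1 | _, _ => 0 end.
have dD : uv_d * D = uv_c * (in_v e - in_u e).
  apply: fpsP => s; apply: fpsP => r.
  rewrite /uv_d /uv_c mulrBl !fpsBE vinvME uinvME -mulrA uinvME.
  case: r => [|r]; first by case: s => [|[|s]] /=; rewrite subrr.
  rewrite vinvME; case: s => [|s]; first by rewrite subrr.
  rewrite !fpsBE /in_v /in_u; case: s => [|s]; case: r => [|r] /=.
  - by rewrite !subrr.
  - by rewrite addn0.
  - by rewrite subr0 add0n ?subr0.
  - by rewrite addnS subrr subr0.
move=> e1.
have {e1}e1 : in_u h * in_v e - in_v e * in_u h = (in_u h * D) *~ g.
  apply: uv_d_reg; rewrite e1 mulrzAr; congr (_ *~ _).
  by rewrite mulrA uv_cC -mulrA [RHS]mulrA uv_dC -[RHS]mulrA dD uv_cC mulrA.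
move=> b; have := congr1 (fun w : B => w b.+1) e1.
rewrite fpsBE /in_u fps_constME fps_Mconst /in_v => e2.
rewrite fpsMzE fps_constME in e2.
have -> : shifted g e b = fps_const (e b.+1) - D b.+1 *~ g.
  apply: fpsP => r; rewrite fpsBE.
  by rewrite fpsMzE; case: r => [|r] /=; rewrite ?mul0rz ?subr0 ?sub0r.
by rewrite mulrBr mulrzAr -e2 opprB addrC subrK.
Qed.

End TwoVariables.

(** * The orthogonal relations *)

Section OrthogonalRelations.
Variables (A : nzRingType) (N : nat).
Implicit Types (i j l m q : 'I_N) (r s : int) (f : int -> int -> A).

Definition omul (c : A) f r s : A := f (r + 1) s - f r (s + 1) - c * f r s.

Variable t : 'I_N -> 'I_N -> fps A.

Definition ocoef i j r : A := if r is Posz n then t i j n else 0.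

Definition ocomm i j l m r s : A :=
  ocoef i j r * ocoef l m s - ocoef l m s * ocoef i j r.

Definition oswap i j l m r s : A :=
  ocoef l j r * ocoef i m s - ocoef l j s * ocoef i m r.

Definition otrace i j l m r s : A :=
  (l == rev_ord i)%:R * (\sum_q ocoef q j r * ocoef (rev_ord q) m s)
  - (m == rev_ord j)%:R * (\sum_q ocoef l (rev_ord q) s * ocoef i q r).

(* The relations [yrel] over an arbitrary ring, with kappa a central element:
   in this form they are stable under transposition in the converse ring. *)
Record orth_series (kap : A) : Prop := OrthSeries {
  os_central : forall z, kap * z = z * kap;
  os0 : forall i j, t i j 0%N = (i == j)%:R;
  os_rel : forall i j l m r s,
    omul 0 (omul kap (ocomm i j l m)) r s
    = omul kap (oswap i j l m) r s - omul 0 (otrace i j l m) r s }.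

Variable kap : A.
Hypothesis os : orth_series kap.

(** This is -(u - v)/(u - v - kappa) times the trace term. Its coefficients are determined by
    recursion on the power of v^-1, starting from that of v^1, which is 0 because t(v) has a scalar
    constant term. *)
Let oquot i j l m r s : A := omul 0 (ocomm i j l m) r s - oswap i j l m r s.

Let oquotE i j l m r s :
  omul kap (oquot i j l m) r s = - omul 0 (otrace i j l m) r s.
Proof.
have := os_rel os i j l m r s; rewrite /oquot /omul !mul0r !subr0 => e.
apply: (addrI (omul kap (oswap i j l m) r s)); rewrite /omul -e.
by ncring.
Qed.

Lemma ocomm0 i j l m r : ocomm i j l m r 0 = 0.
Proof.
rewrite /ocomm /= (os0 os).
by case: (l == m); rewrite ?mulr1 ?mul1r ?mulr0 ?mul0r subrr.
Qed.

Lemma ocomm0l i j l m s : ocomm i j l m 0 s = 0.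
Proof.
rewrite /ocomm /= (os0 os).
by case: (i == j); rewrite ?mulr1 ?mul1r ?mulr0 ?mul0r subrr.
Qed.

Let oquotN1 i j l m r : oquot i j l m r (-1) = 0.
Proof.
rewrite /oquot /omul /oswap (_ : -1 + 1 = 0) // ocomm0 /ocomm /=.
by rewrite !mulr0 !mul0r !subr0.
Qed.

Lemma orth_gl i j l m (r s : nat) : l != rev_ord i -> m != rev_ord j ->
  ocomm i j l m (r.+1 : nat) s - ocomm i j l m r (s.+1 : nat) = oswap i j l m r s.
Proof.
move=> /negbTE li /negbTE mj.
have tr0 r1 s1 : otrace i j l m r1 s1 = 0 by rewrite /otrace li mj !mul0r subr0.
have q0 (n : nat) (r1 : int) : oquot i j l m r1 (n%:Z - 1) = 0.
  elim: n r1 => [|n IH] r1; first by rewrite sub0r oquotN1.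
  have := oquotE i j l m r1 (n%:Z - 1).
  rewrite {1}/omul !IH mulr0 subr0 sub0r /omul !tr0 mulr0 !subr0.
  move=> /oppr_inj; rewrite subrK => e; rewrite -[RHS]e; congr oquot.
  by rewrite -addn1 PoszD addrK.
have := q0 s.+1 r; rewrite -addn1 PoszD addrK /oquot /omul mul0r subr0 => /eqP.
by rewrite subr_eq0 -!PoszD !addn1 => /eqP.
Qed.

Let otraceN1 i j l m r : otrace i j l m r (-1) = 0.
Proof.
rewrite /otrace !big1 ?mulr0 ?subrr // => q _; first by rewrite mul0r.
by rewrite mulr0.
Qed.

Let oquot0 i j l m r : oquot i j l m r 0 = - otrace i j l m r 0.
Proof.
have := oquotE i j l m r (-1).
rewrite /omul (_ : -1 + 1 = 0) // !oquotN1 !otraceN1 mul0r !mulr0 !subr0 !sub0r.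
by rewrite opprK => <-; rewrite opprK.
Qed.

Let oquot1 i j l m r :
  oquot i j l m r 1 = kap * otrace i j l m r 0 - otrace i j l m r 1.
Proof.
have := oquotE i j l m r 0; rewrite /omul (_ : 0 + 1 = 1) // !oquot0 mul0r subr0 => e.
have -> : oquot i j l m r 1 = kap * otrace i j l m r 0 - otrace i j l m (r + 1) 0
   - (- otrace i j l m (r + 1) 0 - oquot i j l m r 1 - kap * (- otrace i j l m r 0)).
  by ncring.
by rewrite e; ncring.
Qed.

Let oquot2 i j l m r : oquot i j l m r 2 = kap * otrace i j l m (r + 1) 0
  + kap * otrace i j l m r 1 - kap * kap * otrace i j l m r 0 - otrace i j l m r 2.
Proof.
have := oquotE i j l m r 1; rewrite /omul (_ : 1 + 1 = 2) // !oquot1 mul0r subr0 => e.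
have -> : oquot i j l m r 2 = kap * otrace i j l m (r + 1) 0 - otrace i j l m (r + 1) 1
   - kap * (kap * otrace i j l m r 0 - otrace i j l m r 1)
   - (kap * otrace i j l m (r + 1) 0 - otrace i j l m (r + 1) 1 - oquot i j l m r 2
   - kap * (kap * otrace i j l m r 0 - otrace i j l m r 1)) by ncring.
by rewrite e; ncring.
Qed.

Let sum_rev_deltal (F : 'I_N -> A) (l0 : 'I_N) :
  \sum_q (rev_ord q == l0)%:R * F q = F (rev_ord l0).
Proof.
rewrite (bigD1 (rev_ord l0)) //= rev_ordK eqxx mul1r big1 ?addr0 // => q.
by rewrite -(inj_eq rev_ord_inj) rev_ordK => /negbTE ->; rewrite mul0r.
Qed.

Let sum_rev_deltar (F : 'I_N -> A) (l0 : 'I_N) :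
  \sum_q F q * (rev_ord q == l0)%:R = F (rev_ord l0).
Proof.
by rewrite -[RHS]sum_rev_deltal; apply: eq_bigr => q _; rewrite mulr_natl mulr_natr.
Qed.

(** The coefficient of v^0, where kappa has not yet appeared: the first modes act on T(u) as
    elements of o_N. *)
Lemma orth_bracket i j l m (r : nat) :
  t i j r * t l m 1%N - t l m 1%N * t i j r
  = (l == j)%:R * t i m r - (i == m)%:R * t l j r
    + (l == rev_ord i)%:R * t (rev_ord m) j r
    - (m == rev_ord j)%:R * t i (rev_ord l) r.
Proof.
have := oquot0 i j l m r; rewrite /oquot /omul (_ : 0 + 1 = 1) // ocomm0 mul0r.
rewrite subr0 sub0r => /(congr1 -%R); rewrite opprK => e.
have -> : t i j r * t l m 1%N - t l m 1%N * t i j r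
   = - (- ocomm i j l m r 1 - oswap i j l m r 0) - oswap i j l m r 0.
  by rewrite /ocomm /=; ncring.
rewrite e /otrace /oswap /=.
under eq_bigr do rewrite (os0 os).
rewrite sum_rev_deltar.
under eq_bigr do rewrite (os0 os) eq_sym.
rewrite sum_rev_deltal (os0 os i m) (os0 os l j) (mulr_natr (t l j r)).
by rewrite -(mulr_natl (t l j r)); ncring.
Qed.

(** The bracket of the first modes at (j, j) and (j', m) is evaluated in both orders, and the two
    results must be opposite. *)
Lemma orth_antisym j m : m != rev_ord j -> t (rev_ord m) j 1%N + t (rev_ord j) m 1%N = 0.
Proof.
move=> mj; have e1 := orth_bracket j j (rev_ord j) m 1.
have e2 := orth_bracket (rev_ord j) m j j 1.
rewrite !eqxx (negbTE mj) rev_ordK eqxx !mul1r mul0r subr0 in e1 e2.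
have jm : j == rev_ord m = false.
  by apply/negbTE; apply: contra mj => /eqP ->; rewrite rev_ordK.
rewrite jm mul0r subr0 in e2.
set a := (rev_ord j == j)%:R * _ in e1 e2; set b := (j == m)%:R * _ in e1 e2.
have -> : t (rev_ord m) j 1%N + t (rev_ord j) m 1%N
   = (a - b + t (rev_ord m) j 1%N) + (b - a + t (rev_ord j) m 1%N) by ncring.
by rewrite -e1 -e2; ncring.
Qed.

Lemma orth_isotropic i : i != rev_ord i ->
  t i (rev_ord i) 1%N = 0 ->
  t i (rev_ord i) 2%N *+ 2 + \sum_q t i (rev_ord q) 1%N * t i q 1%N = 0.
Proof.
move=> ii L0; have ii' := negbTE ii.
pose m := rev_ord i; pose tr := otrace i i i m.
have trE r s : tr r s = - \sum_q ocoef i (rev_ord q) s * ocoef i q r.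
  by rewrite /tr /otrace /m ii' eqxx mul0r mul1r sub0r.
have qE (r s : nat) : oquot i i i m r s
    = ocomm i i i m r.+1 s - ocomm i i i m r s.+1 - oswap i i i m r s.
  by rewrite /oquot /omul mul0r subr0 -!PoszD !addn1.
have z : oquot i i i m 2%N 0%N + oquot i i i m 1%N 1%N + oquot i i i m 0%N 2%N = 0.
  by rewrite !qE (ocomm0 i i i m 3%N) (ocomm0l i i i m 3%N) /oswap; ncring.
have tr_u (r : nat) : tr r 0 = - t i (rev_ord i) r.
  rewrite trE; congr (- _); rewrite -(sum_rev_deltal ((t i)^~ r)).
  apply: eq_bigr => q _ /=.
  by rewrite (os0 os) eq_sym.
have tr_v (s : nat) : tr 0 s = - t i (rev_ord i) s.
  rewrite trE; congr (- _); rewrite (bigD1 i) //= (os0 os) eqxx mulr1.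
  by rewrite big1 ?addr0 // => q /negbTE qi; rewrite (os0 os) eq_sym qi mulr0.
have q0 : oquot i i i m 2%N 0%N = - tr 2%N 0%N := oquot0 i i i m 2%N.
have q1 : oquot i i i m 1%N 1%N = kap * tr 1%N 0%N - tr 1%N 1%N
  := oquot1 i i i m 1%N.
have q2 : oquot i i i m 0%N 2%N = kap * tr 1%N 0%N + kap * tr 0%N 1%N
   - kap * kap * tr 0%N 0%N - tr 0%N 2%N := oquot2 i i i m 0%N.
rewrite q0 q1 q2 (tr_u 2%N) (tr_v 2%N) (tr_u 1%N) (tr_v 1%N) (tr_u 0%N) L0 in z.
rewrite (os0 os) ii' trE /= in z.
by rewrite mulr2n -[RHS]z; ncring.
Qed.

End OrthogonalRelations.

Section Converse.
Variables (A : nzRingType) (N : nat) (t : 'I_N -> 'I_N -> fps A) (kap : A).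

Definition converse_tr : 'I_N -> 'I_N -> fps A^c := fun i j => t j i.

(** Transposing and reversing products changes the sign of the commutator, swap and trace terms
    alike. *)
Lemma orth_series_converse : orth_series t kap ->
  @orth_series A^c N converse_tr kap.
Proof.
case=> kC t0 rel; split=> [z|i j|i j l m r s].
- exact/esym/kC.
- by rewrite eq_sym; apply: t0.
have cE r1 s1 : @ocomm A^c N converse_tr i j l m r1 s1 = - ocomm t j i m l r1 s1.
  by rewrite /ocomm opprB.
have sE r1 s1 : @oswap A^c N converse_tr i j l m r1 s1 = - oswap t j i m l r1 s1.
  by rewrite /oswap opprB.
have tE r1 s1 : @otrace A^c N converse_tr i j l m r1 s1 = - otrace t j i m l r1 s1.
  by rewrite /otrace opprB; congr (_ - _); rewrite [LHS]mulr_natr [RHS]mulr_natl.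
have oE (k0 : A) (f g : int -> int -> A) r1 s1 :
    (forall z : A, k0 * z = z * k0) ->
    (forall r1 s1, f r1 s1 = - g r1 s1) ->
    @omul A^c k0 f r1 s1 = - omul k0 g r1 s1.
  move=> k0C fg; suff e : f (r1 + 1) s1 - f r1 (s1 + 1) - f r1 s1 * k0
    = - omul k0 g r1 s1 by exact: e.
  by rewrite !fg -k0C /omul; ncring.
have zC (z : A) : 0 * z = z * 0 by rewrite mulr0 mul0r.
rewrite (oE 0 _ (omul kap (ocomm t j i m l))) //; last by move=> *; apply: oE.
rewrite (oE kap _ (oswap t j i m l)) // (oE 0 _ (otrace t j i m l)) // rel.
by rewrite opprB opprK addrC.
Qed.

End Converse.

(** * Adjoint action of the Cartan series *)

Definition acts (A : nzRingType) (h : fps A) (g : int) (e : fps A) : Prop :=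
  forall b, fps_const (e b.+1) * h = h * shifted g e b.

Record orth_gauss (A : nzRingType) (N : nat) (t : 'I_N -> 'I_N -> fps A)
    (F : 'I_N -> 'I_N -> fps A) (H : 'I_N -> fps A) (E : 'I_N -> 'I_N -> fps A)
    : Prop := OrthGauss {
  og_t : forall i j, t i j = \sum_m F i m * H m * E m j;
  og_F1 : forall i, F i i = 1;
  og_F0 : forall i j : 'I_N, (i < j)%N -> F i j = 0;
  og_F : forall i j, F i j 0%N = (i == j)%:R;
  og_H : forall i, H i 0%N = 1;
  og_E : forall i j, E i j 0%N = (i == j)%:R;
  og_E1 : forall i, E i i = 1;
  og_E0 : forall i j : 'I_N, (j < i)%N -> E i j = 0 }.

Section CartanAction.
Variables (A : nzRingType) (N R C : nat).
Variables (t : 'I_N -> 'I_N -> fps A) (kap : A).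
Variables (F : 'I_N -> 'I_N -> fps A) (H : 'I_N -> fps A).
Variable (E : 'I_N -> 'I_N -> fps A).
Hypothesis (os : orth_series t kap) (og : orth_gauss t F H E).
Hypothesis (le_RC : (R <= C)%N) (le_RCN : (R + C <= N)%N).
Implicit Types p q r i j k l : 'I_N.

Let le_CN : (C <= N)%N. Proof. exact: leq_trans (leq_addl _ _) le_RCN. Qed.

Let ug_u : unitri_gauss (fun i j => in_u (F i j)) (fun i => in_u (H i))
  (fun i j => in_u (E i j)).
Proof.
split=> [i|i j ij|i|i j ij|i|i].
- by rewrite (og_F1 og).
- by rewrite (og_F0 og) ?in_u0.
- by rewrite (og_E1 og).
- by rewrite (og_E0 og) ?in_u0.
- by apply: in_u_lreg; apply: og_H og _.
- by apply: in_u_rreg; apply: og_H og _.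
Qed.

Let ug_v : unitri_gauss (fun i j => in_v (F i j)) (fun i => in_v (H i))
  (fun i j => in_v (E i j)).
Proof.
split=> [i|i j ij|i|i j ij|i|i].
- by rewrite (og_F1 og) in_v1.
- by rewrite (og_F0 og) ?in_v0.
- by rewrite (og_E1 og) in_v1.
- by rewrite (og_E0 og) ?in_v0.
- by apply: in_v_lreg; apply: og_H og _.
- by apply: in_v_rreg; apply: og_H og _.
Qed.

Let tail_u i j : gauss_tail (fun i j => in_u (F i j)) (fun i => in_u (H i))
  (fun i j => in_u (E i j)) 0 i j = in_u (t i j).
Proof.
rewrite (og_t og) in_u_sum; apply: eq_bigr => m _; by rewrite !in_uM.
Qed.

Let tail_v i j : gauss_tail (fun i j => in_v (F i j)) (fun i => in_v (H i))
  (fun i j => in_v (E i j)) 0 i j = in_v (t i j).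
Proof.
rewrite (og_t og) in_v_sum; apply: eq_bigr => m _; by rewrite !in_vM.
Qed.

(** With indices from 0, k = i' means k + i + 1 = N, which is too large when one index is below R
    and the other below C. *)
Let good_indices i j k l : gl_row R 0 i -> gl_row R 0 k -> gl_cols R C 0 j l ->
  k != rev_ord i /\ l != rev_ord j.
Proof.
rewrite /gl_row /gl_cols /= => iR kR /and3P[jC lC jl]; split.
  apply/eqP => /(congr1 val) /= e.
  have : (N <= k + i.+1)%N by rewrite e subnK.
  rewrite leqNgt => /negP[]; apply: leq_trans le_RCN.
  by rewrite -addSn leq_add // (leq_trans iR).
apply/eqP => /(congr1 val) /= e.
have : (N <= l + j.+1)%N by rewrite e subnK.
rewrite leqNgt => /negP[]; apply: leq_trans le_RCN.
case/orP: jl => [jR|lR]; first by rewrite addnC -addnS leq_add.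
by rewrite -addSn leq_add.
Qed.

Let ocomm_v0 i j k l (r : nat) : ocomm t i j k l r 0%N = 0.
Proof. exact: (ocomm0 os). Qed.

Let ocomm_u0 i j k l (s : nat) : ocomm t i j k l 0%N s = 0.
Proof. exact: (ocomm0l os). Qed.

Let gl_uv i j k l : gl_row R 0 i -> gl_row R 0 k -> gl_cols R C 0 j l ->
  glrel (uv_d A) (uv_c A) (fun i j => in_u (t i j)) (fun i j => in_v (t i j)) i j k l.
Proof.
move=> iR kR jl; have [ki lj] := good_indices iR kR jl.
apply: fpsP => s; apply: fpsP => r.
rewrite /glrel /uv_d /uv_c mulrBl !fpsBE vinvME uinvME -mulrA uinvME.
case: r => [|r].
  by case: s => [|s]; rewrite subr0 // !fpsBE in_uvME in_vuME; apply: ocomm_u0.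
rewrite vinvME; case: s => [|s].
  rewrite sub0r !fpsBE in_uvME in_vuME; apply/eqP; rewrite oppr_eq0; apply/eqP.
  apply: ocomm_v0.
rewrite !fpsBE !in_uvME !in_vuME.
exact: (orth_gl os r s ki lj).
Qed.

(** Exchanging u and v changes the sign of d and fixes c. This version serves the brackets of
    E_{p,q} with later pivots, where E comes in the first variable although [acts] has H in u. *)
Let gl_vu i j k l : gl_row R 0 i -> gl_row R 0 k -> gl_cols R C 0 j l ->
  glrel (- uv_d A) (uv_c A) (fun i j => in_v (t i j)) (fun i j => in_u (t i j)) i j k l.
Proof.
move=> iR kR jl; have [ki lj] := good_indices iR kR jl.
apply: fpsP => s; apply: fpsP => r.
rewrite /glrel /uv_d /uv_c opprB mulrBl !fpsBE vinvME uinvME -mulrA uinvME.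
case: r => [|r].
  case: s => [|s]; rewrite sub0r; apply/eqP; rewrite oppr_eq0 // !fpsBE in_uvME in_vuME.
  by apply/eqP; apply: ocomm_v0.
rewrite vinvME; case: s => [|s].
  by rewrite subr0 !fpsBE in_uvME in_vuME; apply: ocomm_u0.
rewrite !fpsBE !in_uvME !in_vuME.
exact: (orth_gl os s r ki lj).
Qed.

Lemma acts_same p j : (p < R)%N -> (p <= j < C)%N -> acts (H p) 1 (E p j).
Proof.
move=> pR jC; apply: intertwine; rewrite mulr1z.
apply: (pivotH_pivotE (@uv_dC A) (@uv_cC A) (@uv_d_reg A) (@uv_dc_reg A)
  le_RC le_CN ug_u ug_v) => //.
by move=> i1 j1 k1 l1 r1 r2 c1; rewrite /glrel !tail_u !tail_v; apply: gl_uv r1 r2 c1.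
Qed.

Lemma acts_gt p q j : (p < q < R)%N -> (q <= j < C)%N -> acts (H p) 0 (E q j).
Proof.
move=> pR jC; apply: intertwine; rewrite mulr0z.
rewrite (pivotH_E_gt (@uv_dC A) (@uv_cC A) (@uv_d_reg A)
  le_RC le_CN ug_u ug_v _ pR jC) ?subrr ?mulr0 //.
by move=> i1 j1 k1 l1 r1 r2 c1; rewrite /glrel !tail_u !tail_v; apply: gl_uv r1 r2 c1.
Qed.

Let uv_NdC z : - uv_d A * z = z * - uv_d A.
Proof. by rewrite mulNr uv_dC mulrN. Qed.

Lemma acts_next p q : q = p.+1 :> nat -> (q < R)%N -> acts (H q) (- 1) (E p q).
Proof.
move=> qp qR; apply: intertwine; rewrite mulrNz mulr1z.
have := pivotE_H_next uv_NdC (@uv_cC A) (@uv_Nd_reg A) le_RC le_CN ug_v ug_u.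
move=> /(_ _ p q qp qR) e.
set rhs := RHS; have {rhs}-> :
    rhs = uv_c A * (in_u (H q) * (in_u (E p q) - in_v (E p q))).
  by rewrite /rhs; ncring.
rewrite -e; first by ncring.
by move=> i1 j1 k1 l1 r1 r2 c1; rewrite /glrel !tail_u !tail_v; apply: gl_vu r1 r2 c1.
Qed.

Lemma acts_lt p q r : q = p.+1 :> nat -> (q < r < R)%N -> acts (H r) 0 (E p q).
Proof.
move=> qp qR; apply: intertwine; rewrite mulr0z.
have := pivotE_H_gt uv_NdC (@uv_cC A) (@uv_Nd_reg A) le_RC le_CN ug_v ug_u.
move=> /(_ _ p q r qp qR) ->; first by rewrite subrr mulr0.
by move=> i1 j1 k1 l1 r1 r2 c1; rewrite /glrel !tail_u !tail_v; apply: gl_vu r1 r2 c1.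
Qed.

End CartanAction.

(** * Serre sums and their leading terms *)

Section SerreSum.
Variable A : nzRingType.

Definition serre (m : nat) (z : 'I_m -> A) (y : A) : A :=
  \sum_(sigma : 'S_m) nested_comm (fun l => z (sigma l)) y.

Lemma nested_comm0 (z : 'I_0 -> A) y : nested_comm z y = y.
Proof. by rewrite /nested_comm enum_ord0. Qed.

Lemma nested_commS (m : nat) (z : 'I_m.+1 -> A) y :
  nested_comm z y = lie (z ord0) (nested_comm (fun l => z (lift ord0 l)) y).
Proof. by rewrite /nested_comm enum_ordSl /= foldr_map. Qed.

Lemma eq_nested_comm (m : nat) (z1 z2 : 'I_m -> A) y :
  z1 =1 z2 -> nested_comm z1 y = nested_comm z2 y.
Proof. by move=> /funext ->. Qed.

Lemma eq_serre (m : nat) (z1 z2 : 'I_m -> A) y :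
  z1 =1 z2 -> serre z1 y = serre z2 y.
Proof. by move=> /funext ->. Qed.

Lemma serre_perm (m : nat) (z : 'I_m -> A) y (tau : 'S_m) :
  serre (fun l => z (tau l)) y = serre z y.
Proof.
rewrite /serre [RHS](reindex_inj (mulIg tau)); apply: eq_bigr => s _.
by apply: eq_nested_comm => l; rewrite permM.
Qed.

Lemma lieMz (x y : A) (e f : int) : lie (x *~ e) (y *~ f) = lie x y *~ (f * e).
Proof.
by rewrite /lie !mulrzAl !mulrzAr -!mulrzA [e * f]mulrC mulrzBl.
Qed.

Lemma nested_commMz (m : nat) (z : 'I_m -> A) y (e : 'I_m -> int) f :
  nested_comm (fun l => z l *~ e l) (y *~ f)
  = nested_comm z y *~ (f * \prod_l e l).
Proof.
elim: m z e => [|m IH] z e; first by rewrite !nested_comm0 big_ord0 mulr1.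
by rewrite !nested_commS IH lieMz big_ord_recl -mulrA [e _ * _]mulrC.
Qed.

Lemma serreMz (m : nat) (z : 'I_m -> A) y (e : 'I_m -> int) f :
  serre (fun l => z l *~ e l) (y *~ f) = serre z y *~ (f * \prod_l e l).
Proof.
rewrite /serre mulrz_suml; apply: eq_bigr => s _.
rewrite (nested_commMz (fun l => z (s l)) y (fun l => e (s l))).
by congr (_ *~ (_ * _)); rewrite [RHS](reindex_inj (@perm_inj _ s)).
Qed.

End SerreSum.

Section SerreCoefficients.
Variable A : nzRingType.

Lemma fpsM_pairs (f g : fps A) (K n : nat) : (n <= K)%N ->
  (f * g) n = \sum_(i < K.+1) \sum_(j < K.+1) f i * g j *+ (i + j == n)%N.
Proof.
move=> nK; rewrite fpsME (big_ord_widen K.+1 (fun i => f i * g (n - i)%N)) //.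
rewrite big_mkcond; apply: eq_bigr => i _; rewrite ltnS.
case: leqP => [i_n|n_i]; last first.
  rewrite big1 // => j _; case: eqP => // ij.
  by move: n_i; rewrite -ij ltnNge leq_addr.
have jK : (n - i < K.+1)%N by rewrite ltnS (leq_trans (leq_subr _ _)).
rewrite (bigD1 (Ordinal jK)) //= subnKC // eqxx mulr1n big1 ?addr0 // => j.
by rewrite -val_eqE /= -(eqn_add2l i) subnKC // => /negbTE ->.
Qed.

Lemma fps_lie_pairs (f g : fps A) (K n : nat) : (n <= K)%N ->
  lie f g n = \sum_(i < K.+1) \sum_(j < K.+1) lie (f i) (g j) *+ (i + j == n)%N.
Proof.
move=> nK; rewrite /lie fpsBE (fpsM_pairs f g nK) (fpsM_pairs g f nK).
rewrite [X in _ - X]exchange_big /= -sumrB; apply: eq_bigr => i _.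
by rewrite -sumrB; apply: eq_bigr => j _; rewrite addnC mulrnBl.
Qed.

Lemma lie_sumr (x : A) (I : finType) (y : I -> A) :
  lie x (\sum_i y i) = \sum_i lie x (y i).
Proof. by rewrite /lie mulr_sumr mulr_suml -sumrB. Qed.

Lemma lieMnr (x y : A) n : lie x (y *+ n) = lie x y *+ n.
Proof. by rewrite /lie mulrnAr mulrnAl mulrnBl. Qed.

Lemma big_ffun_ordS (T : finType) (m : nat) (G : T -> {ffun 'I_m -> T} -> A) :
  \sum_i \sum_c G i c
  = \sum_(c : {ffun 'I_m.+1 -> T}) G (c ord0) [ffun l => c (lift ord0 l)].
Proof.
rewrite pair_bigA /=.
pose h (c : {ffun 'I_m.+1 -> T}) := (c ord0, [ffun l => c (lift ord0 l)]).
pose h' (p : T * {ffun 'I_m -> T}) :=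
  [ffun l => if unlift ord0 l is Some l' then p.2 l' else p.1].
rewrite (reindex h) //; exists h' => [c _|[i c] _].
  by apply/ffunP => l; rewrite ffunE; case: unliftP => [l'|] ->; rewrite ?ffunE.
rewrite /h ffunE unlift_none; congr (_, _).
by apply/ffunP => l; rewrite !ffunE liftK.
Qed.

(** The common bound K, instead of n, makes the families of exponents range over one finite type,
    the same for all coefficients met in the induction. *)
Lemma fps_nested_comm (m : nat) (w : 'I_m -> fps A) (v : fps A) (K n : nat) :
  (n <= K)%N ->
  nested_comm w v n = \sum_(c : {ffun 'I_m -> 'I_K.+1}) \sum_(c0 < K.+1)
     nested_comm (fun l => w l (c l)) (v c0) *+ (\sum_l c l + c0 == n)%N.
Proof.
elim: m w n => [|m IH] w n nK.
  have nK' : (n < K.+1)%N by [].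
  rewrite (big_pred1 [ffun=> ord0]) => [|c]; last first.
    by apply/esym/eqP/ffunP => -[].
  rewrite (bigD1 (Ordinal nK')) //= big_ord0 add0n eqxx !nested_comm0.
  rewrite big1 ?addr0 // => j; rewrite -val_eqE /= add0n => /negbTE ->.
  by rewrite mulr0n.
rewrite nested_commS (fps_lie_pairs _ _ nK).
pose G i (c : {ffun 'I_m -> 'I_K.+1}) := \sum_(c0 < K.+1)
  lie (w ord0 i) (nested_comm (fun l => w (lift ord0 l) (c l)) (v c0))
    *+ (i + \sum_l c l + c0 == n)%N.
transitivity (\sum_(i < K.+1) \sum_c G i c).
  apply: eq_bigr => i _.
  transitivity (\sum_(j < K.+1) \sum_(c : {ffun 'I_m -> 'I_K.+1}) \sum_(c0 < K.+1)
    lie (w ord0 i) (nested_comm (fun l => w (lift ord0 l) (c l)) (v c0))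
      *+ ((\sum_l c l + c0 == j) * (i + j == n))%N).
    apply: eq_bigr => j _; rewrite IH; last by rewrite -ltnS.
    rewrite lie_sumr -sumrMnl; apply: eq_bigr => c _.
    rewrite lie_sumr -sumrMnl; apply: eq_bigr => c0 _.
    by rewrite lieMnr -mulrnA.
  rewrite exchange_big; apply: eq_bigr => c _ /=; rewrite exchange_big.
  apply: eq_bigr => c0 _ /=; rewrite sumrMnr; congr (_ *+ _).
  set T := (\sum_l c l)%N; have [e|ne] := eqVneq (i + T + c0)%N n; last first.
    rewrite big1 // => j _; case: eqP => // <-.
    by rewrite addnA (negbTE ne).
  have jK : (T + c0 < K.+1)%N by rewrite ltnS (leq_trans _ nK) // -e -addnA leq_addl.
  rewrite (bigD1 (Ordinal jK)) //= eqxx addnA e eqxx big1 // => j.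
  by rewrite -val_eqE /= eq_sym => /negbTE ->.
rewrite big_ffun_ordS; apply: eq_bigr => c _; apply: eq_bigr => c0 _.
rewrite nested_commS big_ord_recl.
under eq_nested_comm do rewrite ffunE.
by congr (_ *+ (_ + _ + _ == _)%N); apply: eq_bigr => l _; rewrite ffunE.
Qed.

(** For each permutation the families of exponents are permuted along, so that the summands group
    into Serre sums again. *)
Lemma fps_serre (m : nat) (w : 'I_m -> fps A) (v : fps A) (K n : nat) :
  (n <= K)%N ->
  serre w v n = \sum_(c : {ffun 'I_m -> 'I_K.+1}) \sum_(c0 < K.+1)
     serre (fun l => w l (c l)) (v c0) *+ (\sum_l c l + c0 == n)%N.
Proof.
move=> nK; rewrite /serre fps_sumE.
transitivity (\sum_(s : 'S_m) \sum_(c : {ffun 'I_m -> 'I_K.+1}) \sum_(c0 < K.+1)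
   nested_comm (fun l => w (s l) (c (s l))) (v c0) *+ (\sum_l c l + c0 == n)%N).
  apply: eq_bigr => s _; rewrite (fps_nested_comm _ _ nK).
  pose h (c : {ffun 'I_m -> 'I_K.+1}) := [ffun l => c (s l)].
  rewrite (reindex h) /=; last first.
    exists (fun c : {ffun 'I_m -> 'I_K.+1} => [ffun l => c ((s^-1)%g l)]) => c _;
      by apply/ffunP => l; rewrite !ffunE ?permK ?permKV.
  apply: eq_bigr => c _; apply: eq_bigr => c0 _.
  under eq_nested_comm do rewrite ffunE.
  congr (_ *+ (_ + _ == _)%N); rewrite [RHS](reindex_inj (@perm_inj _ s)).
  by apply: eq_bigr => l _; rewrite ffunE.
rewrite exchange_big; apply: eq_bigr => c _; rewrite exchange_big.
by apply: eq_bigr => c0 _; rewrite -sumrMnl.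
Qed.

Lemma fps_constB (a b : A) : fps_const (a - b) = fps_const a - fps_const b.
Proof. by apply: fpsP => -[|n]; rewrite fpsBE //= subrr. Qed.

Lemma lie_intertwine (h f g : fps A) (x y : A) :
  fps_const x * h = h * f -> fps_const y * h = h * g ->
  fps_const (lie x y) * h = h * lie f g.
Proof.
move=> e1 e2; rewrite /lie fps_constB !fps_constM mulrBl mulrBr -!mulrA.
by rewrite e2 e1 !mulrA e1 e2.
Qed.

Lemma nested_comm_intertwine (m : nat) (h : fps A) (z : 'I_m -> A) (y : A)
    (w : 'I_m -> fps A) (v : fps A) :
  (forall l, fps_const (z l) * h = h * w l) -> fps_const y * h = h * v ->
  fps_const (nested_comm z y) * h = h * nested_comm w v.
Proof.
move=> ew ev; elim: m z w ew => [|m IH] z w ew; first by rewrite !nested_comm0.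
by rewrite !nested_commS; apply: lie_intertwine => //; apply: IH.
Qed.

Lemma serre_intertwine (m : nat) (h : fps A) (z : 'I_m -> A) (y : A)
    (w : 'I_m -> fps A) (v : fps A) :
  (forall l, fps_const (z l) * h = h * w l) -> fps_const y * h = h * v ->
  fps_const (serre z y) * h = h * serre w v.
Proof.
move=> ew ev; rewrite /serre fps_const_sum mulr_suml mulr_sumr.
by apply: eq_bigr => s _; apply: nested_comm_intertwine.
Qed.

End SerreCoefficients.

Section SerreModes.
Variables (A : nzRingType) (e f : fps A) (m : nat).

Definition serre_modes (r : 'I_m -> nat) (s : nat) : A :=
  serre (fun l => e (r l).+1) (f s.+1).

(** The coefficient of u^-a in [shifted g e b] is this multiple of the mode b + [a.-1]; the
    exponents 0 and 1 both give the mode b. *)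
Definition shift_coef (g : int) (a : nat) : int := if a is 0%N then 1 else - g.

Lemma shiftedE (g : int) (e' : fps A) b a :
  shifted g e' b a = e' (b + a.-1).+1 *~ shift_coef g a.
Proof. by case: a => [|a] /=; rewrite ?addn0 ?mulr1z // mulrNz addnC. Qed.

Lemma sum_predn (T : finType) (P : pred T) (c : T -> nat) :
  (forall l, P l -> c l = 0%N) \/ (\sum_(l | P l) (c l).-1 < \sum_(l | P l) c l)%N.
Proof.
have [/existsP[l /andP[Pl cl]]|] := boolP [exists l, P l && (c l != 0%N)].
  right; rewrite !(bigD1 l Pl) /= -addSn leq_add //; first by rewrite ltn_predL lt0n.
  by apply: leq_sum => l' _; apply: leq_pred.
rewrite negb_exists => /forallP c0; left => l Pl.
by have := c0 l; rewrite Pl /= negbK => /eqP.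
Qed.

(** The Serre sum S of the given modes vanishes by [low], so conjugating it by h gives 0; take the
    coefficient of u^-(M + 1). A factor contributing u^-c with c > 0 raises its mode by c - 1 only,
    so the total degree rises by M + 1 minus the number of such factors. Only terms with a single
    such factor reach degree + M; all others vanish by [low]. *)
Lemma serre_leading (h : fps A) (a b : int) (r : 'I_m -> nat) (s M : nat) :
  h 0%N = 1 -> acts h a e -> acts h b f -> (0 < M)%N ->
  (forall r' s', (\sum_l r' l + s' < \sum_l r l + s + M)%N ->
     serre_modes r' s' = 0) ->
  (\sum_l serre_modes (fun l' => (r l' + (l' == l) * M)%N) s) *~ a
    + serre_modes r (s + M) *~ b = 0.
Proof.
move=> h0 ha hb M0 low.
pose w l := shifted a e (r l); pose v := shifted b f s.
have S0 : serre w v = 0.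
  apply: (fps_lreg h0); rewrite -(@serre_intertwine A m h (fun l => e (r l).+1) (f s.+1)).
  - have -> : serre (fun l => e (r l).+1) (f s.+1) = 0.
      by apply: low; rewrite -addnA ltn_add2l -{1}[s]addn0 ltn_add2l.
    by rewrite mulr0; apply: fpsP => n; rewrite fps_constME mul0r.
  - by move=> l; apply: ha.
  - exact: hb.
have := congr1 (fun z : fps A => z M.+1) S0.
rewrite (fps_serre _ _ (leqnn M.+1)) fps0E.
pose C := {ffun 'I_m -> 'I_M.+2}.
pose deg (p : C * 'I_M.+2) := (\sum_l p.1 l + p.2)%N.
pose G (p : C * 'I_M.+2) := serre_modes (fun l => (r l + (p.1 l).-1)%N) (s + p.2.-1)
  *~ (shift_coef b p.2 * \prod_l shift_coef a (p.1 l)) *+ (deg p == M.+1).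
have -> : \sum_(c : C) \sum_(c0 < M.+2) serre (fun l => w l (c l)) (v c0)
    *+ (\sum_l c l + c0 == M.+1)%N = \sum_p G p.
  rewrite pair_bigA; apply: eq_bigr => -[c c0] _; rewrite /G /=; congr (_ *+ _).
  rewrite -serreMz /v shiftedE; congr (serre _ _).
  by apply: funext => l; rewrite /w shiftedE.
(* The surviving families: the whole exponent M + 1, which is [ord_max], falls on one factor e or on
   f. *)
pose g (i : 'I_m + unit) : C * 'I_M.+2 := match i with
  | inl l => ([ffun l' => if l' == l then ord_max else ord0], ord0)
  | inr _ => ([ffun=> ord0], ord_max) end.
have g_inj : injective g.
  move=> [l|[]] [l'|[]] //= [] /ffunP /(_ l); rewrite !ffunE eqxx.
  by case: eqP => [-> //|_] /(congr1 val).
rewrite (bigID [in g @: setT]) /= [X in _ + X]big1 ?addr0; last first.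
  move=> [c c0] /imsetP ng; rewrite /G; case: eqP => [|//]; rewrite /deg /= => dE.
  rewrite low ?mul0rz ?mulr1n //.
  rewrite big_split /= -!addnA ltn_add2l addnCA ltn_add2l.
  have [c00|c00] := eqVneq c0 ord0; last first.
    have [c_0|lt_c] := sum_predn predT (fun l => c l : nat).
      case: ng; exists (inr tt); rewrite ?inE //; congr (_, _).
        by apply/ffunP => l; rewrite ffunE; apply: val_inj; rewrite /= c_0.
      by apply: val_inj; move: dE; rewrite big1 // => l _; apply: c_0.
    have : (0 < c0)%N by rewrite lt0n.
    by move: lt_c dE => /=; lia.
  have [l cl] : exists l, (c l : nat) != 0%N.
    apply/existsP; rewrite -negb_forall; apply/negP => /forallP c_0.
    by move: dE; rewrite c00 /= addn0 big1 // => l _; apply/eqP.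
  have [c_0|lt_c] := @sum_predn _ (predC1 l) (fun l => c l : nat).
    case: ng; exists (inl l); rewrite ?inE //; congr (_, _) => //.
    apply/ffunP => l'; rewrite ffunE; case: eqVneq => [->|l'l]; apply: val_inj => /=.
      by move: dE; rewrite c00 /= addn0 (bigD1 l) //= big1 ?addn0 // => l1; apply: c_0.
    by rewrite c_0.
  move: dE lt_c; rewrite c00 (bigD1 l) //= (bigD1 l (P := predT)) //=.
  by move: cl => /=; lia.
rewrite big_imset /=; last by move=> ? ? _ _; apply: g_inj.
rewrite (eq_bigl predT) => [|i]; last by rewrite inE.
rewrite big_sumType /= [X in _ + X](big_pred1 tt) => [|[] //].
have -> : G ([ffun=> ord0], ord_max) = - (serre_modes r (s + M) *~ b).
  pose c0 : C := [ffun=> ord0].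
  have sum0 : (\sum_l c0 l)%N = 0%N by rewrite big1 // => l _; rewrite ffunE.
  have prod1 : \prod_l shift_coef a (c0 l) = 1.
    by rewrite big1 // => l _; rewrite ffunE.
  rewrite /G /deg /= -/c0 sum0 prod1 add0n eqxx mulr1n mulr1 mulrNz.
  congr (- (_ *~ _)); apply: eq_serre => l.
  by rewrite ffunE addn0.
rewrite (eq_bigr (fun l => - (serre_modes (fun l' => (r l' + (l' == l) * M)%N) s *~ a))).
  by rewrite sumrN -mulrz_suml -opprD => /eqP; rewrite oppr_eq0 => /eqP.
move=> l _; pose c1 : C := [ffun l' => if l' == l then ord_max else ord0].
have sum1 : (\sum_l' c1 l')%N = M.+1.
  rewrite (bigD1 l) //= ffunE eqxx big1 ?addn0 // => l' /negbTE l'l.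
  by rewrite ffunE l'l.
have prod1 : \prod_l' shift_coef a (c1 l') = - a.
  rewrite (bigD1 l) //= ffunE eqxx /= big1 ?mulr1 // => l' /negbTE l'l.
  by rewrite ffunE l'l.
rewrite /G /deg /= -/c1 sum1 prod1 !addn0 eqxx mulr1n mul1r mulrNz.
congr (- (_ *~ _)); apply: eq_serre => l'.
by rewrite ffunE; case: eqP => _ /=; rewrite ?mul1n.
Qed.

(* Induction on the total degree and, in a given degree, on the number of
   nonzero [r l]: moving one nonzero [r l] to all the positions holding 0 gives
   equal terms by symmetry, the other terms having fewer nonzero positions. *)
Lemma serre_vanish :
  (forall (j : nat) (a : A), (0 < j <= m)%N -> a *+ j = 0 -> a = 0) ->
  (forall r s M, (0 < M)%N ->
    (forall r' s', (\sum_l r' l + s' < \sum_l r l + s + M)%N ->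
       serre_modes r' s' = 0) ->
    \sum_l serre_modes (fun l' => (r l' + (l' == l) * M)%N) s = 0
    /\ serre_modes r (s + M) = 0) ->
  serre_modes (fun=> 0%N) 0 = 0 -> forall r s, serre_modes r s = 0.
Proof.
move=> tors lead S0 r s; have [D] := ubnP (\sum_l r l + s)%N.
elim: D r s => // D IH r s; rewrite ltnS leq_eqVlt => /predU1P[rsD|]; last exact: IH.
have low r' s' : (\sum_l r' l + s' < D)%N -> serre_modes r' s' = 0 by apply: IH.
have [s0|s0] := posnP s; last first.
  by have [|_] := lead r 0%N s s0; rewrite ?addn0 ?rsD.
move: rsD; rewrite {s}s0 addn0 => rD; have [k] := ubnP #|[set l | r l != 0%N]|.
elim: k r rD => // k IHk r rD supp_k.
have [/existsP[l rl]|] := boolP [exists l, r l != 0%N]; last first.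
  rewrite negb_exists => /forallP r0; rewrite -[RHS]S0.
  by congr serre_modes; apply: funext => l; apply/eqP; rewrite -[_ == _]negbK.
pose r0 l' := if l' == l then 0%N else r l'.
have r0D : (\sum_l r0 l + r l = D)%N.
  rewrite -rD !(bigD1 l (P := predT)) //= /r0 eqxx add0n addnC; congr (_ + _)%N.
  by apply: eq_bigr => l' /negbTE ->.
have rl0 : (0 < r l)%N by rewrite lt0n.
have [] := lead r0 0%N (r l) rl0; first by rewrite addn0 r0D.
move=> sum0 _; move: sum0; rewrite (bigID (fun l' => r0 l' == 0%N)) /=.
rewrite [X in _ + X]big1 ?addr0 => [|l' r0l']; last first.
  have l'l : l' != l by apply: contra r0l'; rewrite /r0 => ->.
  apply: IHk.
    rewrite big_split /= -big_distrl /= -[RHS]r0D; congr (_ + _)%N.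
    rewrite (bigD1 l') //= eqxx big1 ?addn0 ?mul1n // => i /negbTE ->; done.
  rewrite -ltnS (leq_trans _ supp_k) // ltnS; apply: proper_card.
  apply/properP; split.
    apply/subsetP => i; rewrite !inE /r0; case: (eqVneq i l) => [-> //|_].
    case: (eqVneq i l') => [-> _|_]; last by rewrite addn0.
    by move: r0l'; rewrite /r0 (negbTE l'l).
  by exists l; rewrite !inE // /r0 eqxx [l == l']eq_sym (negbTE l'l).
rewrite (eq_bigr (fun=> serre_modes r 0%N)) => [|l' r0l']; last first.
  rewrite /serre_modes -[RHS](serre_perm _ _ (tperm l l')).
  congr (serre _ _); apply: funext => i; congr (e _.+1).
  rewrite /r0; case: tpermP => [->|->|/eqP il /eqP il'].
  - rewrite eqxx; case: eqVneq => [ll'|ll']; first by rewrite -ll' mul1n.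
    by move: r0l'; rewrite /r0 [l' == l]eq_sym (negbTE ll') => /eqP ->.
  - by rewrite eqxx mul1n; move: r0l'; rewrite /r0 => /eqP ->.
  - by rewrite (negbTE il) (negbTE il') addn0.
rewrite sumr_const => /tors; apply; apply/andP; split.
  by apply/card_gt0P; exists l; rewrite unfold_in /r0 eqxx.
by rewrite -[X in (_ <= X)%N]card_ord max_card.
Qed.

End SerreModes.

Section SerreActors.
Variables (A : nzRingType) (e f : fps A).

(** Weights (1, 0) for h and (g, 1) for h' make the two leading-term equations triangular, whatever
    g is. *)
Lemma serre_vanish_left (m : nat) (h h' : fps A) (g : int) :
  (forall (j : nat) (a : A), (0 < j <= m)%N -> a *+ j = 0 -> a = 0) ->
  h 0%N = 1 -> h' 0%N = 1 ->
  acts h 1 e -> acts h 0 f -> acts h' g e -> acts h' 1 f ->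
  serre_modes e f (fun _ : 'I_m => 0%N) 0 = 0 ->
  forall (r : 'I_m -> nat) s, serre_modes e f r s = 0.
Proof.
move=> tors h0 h0' he hf he' hf'; apply: serre_vanish => // r s M M0 low.
have := serre_leading h0 he hf M0 low; rewrite mulr1z mulr0z addr0 => sum0.
split=> //; have := serre_leading h0' he' hf' M0 low.
by rewrite sum0 mul0rz add0r mulr1z.
Qed.

Lemma serre_vanish_right (m : nat) (h h' : fps A) (g : int) :
  (forall (j : nat) (a : A), (0 < j <= m)%N -> a *+ j = 0 -> a = 0) ->
  h 0%N = 1 -> h' 0%N = 1 ->
  acts h 0 e -> acts h 1 f -> acts h' 1 e -> acts h' g f ->
  serre_modes e f (fun _ : 'I_m => 0%N) 0 = 0 ->
  forall (r : 'I_m -> nat) s, serre_modes e f r s = 0.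
Proof.
move=> tors h0 h0' he hf he' hf'; apply: serre_vanish => // r s M M0 low.
have := serre_leading h0 he hf M0 low; rewrite mulr1z mulr0z add0r => S0.
split=> //; have := serre_leading h0' he' hf' M0 low.
by rewrite S0 mul0rz addr0 mulr1z.
Qed.

(* Here h only gives S(a + M, s) = - S(a, s + M); in degree at least 2 this
   identifies S(D, 0) with its opposite through any S(a, s) with a, s > 0. *)
Lemma serre_vanish_diag (h : fps A) :
  (forall a : A, a *+ 2 = 0 -> a = 0) -> h 0%N = 1 -> acts h 1 e -> acts h 1 f ->
  serre_modes e f (fun _ : 'I_1 => 0%N) 0 = 0 ->
  serre_modes e f (fun _ : 'I_1 => 1%N) 0 = 0 ->
  forall (r : 'I_1 -> nat) s, serre_modes e f r s = 0.
Proof.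
move=> tors h0 he hf S00 S10 r s; pose S a s := serre_modes e f (fun _ : 'I_1 => a) s.
have rE (r' : 'I_1 -> nat) s' : serre_modes e f r' s' = S (r' ord0) s'.
  by congr serre_modes; apply: funext => i; rewrite (ord1 i).
rewrite rE; move: (r ord0) => a {r}; have [D] := ubnP (a + s)%N.
elim: D a s => // D IH a s; rewrite ltnS leq_eqVlt => /predU1P[asD|]; last exact: IH.
have lead a' s' M : (0 < M)%N -> (a' + s' + M)%N = D ->
    S (a' + M)%N s' = - S a' (s' + M)%N.
  move=> M0 e1; apply/eqP; rewrite -addr_eq0; apply/eqP.
  rewrite -[RHS](serre_leading (r := fun _ : 'I_1 => a') (s := s') h0 he hf M0).
    rewrite !mulr1z big_ord1; congr (_ + _); congr serre_modes; apply: funext => i.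
    by rewrite (ord1 i) eqxx mul1n.
  by move=> r' s1; rewrite !big_ord1 e1 rE => /IH.
have SD0 : S D 0%N = 0.
  case: D {IH asD} lead => [|[|D]] lead //.
  have e1 : S D.+2 0%N = - S D.+1 1%N.
    by rewrite -[X in S X 0%N]addn1 lead // addn0 addn1.
  have e2 : S D.+1 1%N = - S 0%N D.+2.
    by rewrite -[X in S X 1%N]add0n lead // add0n add1n.
  have e3 : S D.+2 0%N = - S 0%N D.+2 by rewrite -[X in S X 0%N]add0n lead.
  by apply: tors; rewrite mulr2n {2}e3 e1 e2 opprK subrr.
have [s0|s0] := posnP s; first by move: asD; rewrite s0 addn0 => ->.
have := lead a 0%N s s0; rewrite addn0 add0n asD SD0 => /(_ erefl) /esym /eqP.
by rewrite oppr_eq0 => /eqP.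
Qed.

End SerreActors.

(** * Low degrees *)

Lemma rev_ord_neq (N : nat) (p q : 'I_N) : (p + q).+1 != N -> p != rev_ord q.
Proof. by move=> pq; apply: contra pq => /eqP ->; rewrite /= -addnS subnK. Qed.

Section LowDegree.
Variables (A : nzRingType) (N : nat).
Variables (t : 'I_N -> 'I_N -> fps A) (kap : A).
Variables (F : 'I_N -> 'I_N -> fps A) (H : 'I_N -> fps A).
Variable (E : 'I_N -> 'I_N -> fps A).
Hypothesis (os : orth_series t kap) (og : orth_gauss t F H E).
Implicit Types (a b c d i j l m q : 'I_N).
Local Notation L i j := (t i j 1%N).

Lemma fpsM1 (f g : fps A) : (f * g) 1%N = f 0%N * g 1%N + f 1%N * g 0%N.
Proof. by rewrite fpsME !big_ord_recl big_ord0 addr0. Qed.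

Lemma fpsM2 (f g : fps A) :
  (f * g) 2%N = f 0%N * g 2%N + f 1%N * g 1%N + f 2%N * g 0%N.
Proof. by rewrite fpsME !big_ord_recl big_ord0 addr0 addrA. Qed.

Lemma sum_deltal (G : 'I_N -> A) i : \sum_m (i == m)%:R * G m = G i.
Proof.
rewrite (bigD1 i) //= eqxx mul1r big1 ?addr0 // => m /negbTE mi.
by rewrite eq_sym mi mul0r.
Qed.

Lemma sum_deltar (G : 'I_N -> A) j : \sum_m G m * (m == j)%:R = G j.
Proof.
rewrite (bigD1 j) //= eqxx mulr1 big1 ?addr0 // => m /negbTE ->.
by rewrite mulr0.
Qed.

Lemma gauss_coef1 i j : L i j = F i j 1%N + (i == j)%:R * H i 1%N + E i j 1%N.
Proof.
rewrite (og_t og) fps_sumE.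
have tE m : (F i m * H m * E m j) 1%N = F i m 1%N * (m == j)%:R
    + ((i == m)%:R * H m 1%N * (m == j)%:R + (i == m)%:R * E m j 1%N).
  by rewrite !fpsM1 fpsME big_ord1 !(og_F og, og_E og, og_H og); ncring.
rewrite (eq_bigr _ (fun m _ => tE m)) !big_split /= !sum_deltar sum_deltal.
by rewrite addrA; case: eqVneq => [->|_]; rewrite ?mul0r.
Qed.

Lemma gauss_E1 i j : (i < j)%N -> E i j 1%N = L i j.
Proof.
move=> ij; have /negbTE ji : i != j by rewrite -val_eqE /= ltn_eqF.
by rewrite gauss_coef1 (og_F0 og ij) fps0E ji mul0r !add0r.
Qed.

Lemma gauss_F1 i j : (j < i)%N -> F i j 1%N = L i j.
Proof.
move=> ij; have /negbTE ji : i != j by rewrite -val_eqE /= gtn_eqF.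
by rewrite gauss_coef1 (og_E0 og ij) fps0E ji mul0r !addr0.
Qed.

Lemma gauss_H1 i : H i 1%N = L i i.
Proof.
rewrite gauss_coef1 (og_F1 og) (og_E1 og) eqxx mul1r.
by rewrite !fps1E addr0 add0r.
Qed.

Lemma gauss_E2 i j : (i < j)%N ->
  E i j 2%N = t i j 2%N - L i i * L i j - \sum_(m < N | (m < i)%N) L i m * L m j.
Proof.
move=> ij; have /negbTE ji : i != j by rewrite -val_eqE /= ltn_eqF.
apply/eqP; rewrite -subr_eq0; apply/eqP; rewrite {1}(og_t og) fps_sumE.
have tE m : (F i m * H m * E m j) 2%N = (F i m 2%N + F i m 1%N * H m 1%N) * (m == j)%:R
    + ((i == m)%:R * (H m 2%N * (m == j)%:R + E m j 2%N + H m 1%N * E m j 1%N)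
    + F i m 1%N * E m j 1%N).
  by rewrite !fpsM2 !fpsM1 fpsME big_ord1 !(og_F og, og_E og, og_H og); ncring.
rewrite (eq_bigr _ (fun m _ => tE m)) !big_split /= sum_deltar sum_deltal ji.
rewrite (og_F0 og ij) !fps0E !gauss_H1 gauss_E1 //.
have -> : \sum_m F i m 1%N * E m j 1%N = \sum_(m < N | (m < i)%N) L i m * L m j.
  rewrite (bigID (fun m : 'I_N => (m < i)%N)) /= [X in _ + X]big1 ?addr0.
    by apply: eq_bigr => m mi; rewrite gauss_F1 // gauss_E1 // (ltn_trans mi).
  move=> m; rewrite -leqNgt leq_eqVlt => /predU1P[/val_inj <-|im].
    by rewrite (og_F1 og) fps1E mul0r.
  by rewrite (og_F0 og im) mul0r.
by rewrite /= !mulr0n; ncring.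
Qed.

Lemma bracketL i j l m (r : nat) : lie (t i j r) (L l m)
  = (l == j)%:R * t i m r - (i == m)%:R * t l j r
    + (l == rev_ord i)%:R * t (rev_ord m) j r
    - (m == rev_ord j)%:R * t i (rev_ord l) r.
Proof. exact: orth_bracket os i j l m r. Qed.

Lemma bracketL0 i j l m (r : nat) : l != j -> i != m -> l != rev_ord i ->
  m != rev_ord j -> lie (t i j r) (L l m) = 0.
Proof.
move=> /negbTE lj /negbTE im /negbTE li /negbTE mj.
by rewrite bracketL lj im li mj !mul0r; ncring.
Qed.

Lemma L_isotropic i : i != rev_ord i -> (forall a : A, a *+ 2 = 0 -> a = 0) ->
  L i (rev_ord i) = 0.
Proof.
move=> ii tors; apply: tors; rewrite mulr2n.
have := orth_antisym os (j := rev_ord i) (m := rev_ord i).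
by rewrite rev_ordK eq_sym => /(_ ii).
Qed.

Lemma bracket_isotropic a b (r : nat) : a != b -> a != rev_ord a -> a != rev_ord b ->
  lie (t a b r) (L a (rev_ord b)) = - t a (rev_ord a) r.
Proof.
move=> /negbTE ab /negbTE aa /negbTE ab'.
by rewrite bracketL ab aa ab' eqxx !mul0r mul1r; ncring.
Qed.

Lemma lieMl (x y z : A) : lie (x * y) z = x * lie y z + lie x z * y.
Proof. by rewrite /lie; ncring. Qed.

Lemma lie0_comm (x y : A) : lie x y = 0 -> x * y = y * x.
Proof. by move=> /eqP; rewrite subr_eq0 => /eqP. Qed.

(* The case D_2, where the isotropy of row a enters. *)
Lemma isotropic_degree1 a b : (forall z : A, z *+ 2 = 0 -> z = 0) ->
  N = (a.+2).*2 -> (a < b)%N -> (a < rev_ord b)%N ->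
  lie (E a b 2%N) (L a (rev_ord b)) = 0.
Proof.
move=> tors NE ab ab'.
have aa : a != rev_ord a by apply: rev_ord_neq; move: NE ab; lia.
have La0 : L a (rev_ord a) = 0 by apply: L_isotropic.
have nab : a != b by rewrite -val_eqE /= ltn_eqF.
have nab' : a != rev_ord b by rewrite -val_eqE ltn_eqF.
have b3 : (b < a.+3)%N by move: ab' => /=; move: NE; lia.
have bb : lie (L a b) (L a (rev_ord b)) = 0.
  by rewrite bracket_isotropic // La0 oppr0.
have comm_m m : (m < a)%N -> lie (L a m) (L a (rev_ord m)) = 0.
  move=> ma; rewrite bracket_isotropic ?La0 ?oppr0 // -?val_eqE /=.
    by rewrite gtn_eqF.
  by apply/eqP => /=; move: NE ma; lia.
have low_m m : (m < a)%N ->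
    lie (L a m * L m b) (L a (rev_ord b)) = L a m * L a (rev_ord m).
  move=> ma; rewrite lieMl.
  have -> : lie (L a m) (L a (rev_ord b)) = 0.
    apply: bracketL0 => //; first by rewrite -val_eqE /= gtn_eqF.
    by apply/eqP => /rev_ord_inj e; move: ma ab; rewrite e; lia.
  rewrite bracketL eqxx mul1r.
  have /negbTE -> := nab.
  have /negbTE -> : m != rev_ord b.
    by rewrite -val_eqE ltn_eqF // (ltn_trans ma).
  have am : a != rev_ord m by apply: rev_ord_neq; move: NE ma; lia.
  have := orth_antisym os (j := rev_ord a) (m := rev_ord m).
  rewrite !rev_ordK eq_sym => /(_ am) /eqP; rewrite addr_eq0 => /eqP ->.
  rewrite (negbTE am).
  by rewrite !mul0r; ncring.
have aaE : lie (L a a) (L a (rev_ord b)) = L a (rev_ord b).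
  rewrite bracketL eqxx mul1r.
  have /negbTE -> := nab'; have /negbTE -> := aa.
  have /negbTE -> : rev_ord b != rev_ord a.
    by apply: contra_neq nab => /rev_ord_inj ->.
  by rewrite !mul0r; ncring.
pose S := \sum_(m < N | (m < a)%N) L a m * L a (rev_ord m).
have E2 : lie (E a b 2%N) (L a (rev_ord b))
    = - t a (rev_ord a) 2%N - L a (rev_ord b) * L a b - S.
  have lieB (x y z : A) : lie (x - y) z = lie x z - lie y z by rewrite /lie; ncring.
  rewrite gauss_E2 // !lieB lieMl aaE bb mulr0 add0r bracket_isotropic //.
  congr (_ - _); rewrite /S /lie mulr_suml mulr_sumr -sumrB.
  by apply: eq_bigr => m /low_m.
apply: tors; rewrite E2.
have := orth_isotropic os aa La0.
(* The indices pair up as q, q' with q < a + 2, since N = 2 (a + 2). Those below a give S twice, a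
   itself gives 0 because [L a (rev_ord a)] is 0, and a + 1 is b or b'. *)
have -> : \sum_q L a (rev_ord q) * L a q = (S + L a (rev_ord b) * L a b) *+ 2.
  pose G q := L a (rev_ord q) * L a q + L a q * L a (rev_ord q).
  have -> : \sum_q L a (rev_ord q) * L a q = \sum_(q < N | (q < a.+2)%N) G q.
    rewrite (bigID (fun q : 'I_N => (q < a.+2)%N)) /=.
    rewrite [X in _ + X](reindex_inj rev_ord_inj) /=.
    rewrite /G [RHS]big_split /=; congr (_ + _).
    apply: eq_big => [q|q _]; last by rewrite rev_ordK.
    by move: NE (ltn_ord q); rewrite -leqNgt; lia.
  have [c cE Gc] : exists2 c : 'I_N, c = a.+1 :> nat & G c = L a (rev_ord b) * L a b *+ 2.
    have bC := lie0_comm bb.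
    have [ba|ba] := eqVneq (b : nat) a.+1.
      by exists b => //; rewrite /G bC mulr2n.
    exists (rev_ord b); first by move: ba ab b3 => /=; lia.
    by rewrite /G rev_ordK bC mulr2n.
  rewrite (bigID (fun q : 'I_N => (q < a)%N)) /= mulrnDl; congr (_ + _).
    rewrite -sumrMnl; apply: eq_big => [q|q /andP[_ qa]]; first by lia.
    by rewrite /G (lie0_comm (comm_m q qa)) mulr2n.
  rewrite (bigD1 a) /=; last by rewrite ltnn; lia.
  rewrite {1}/G La0 mul0r mulr0 addr0 add0r (big_pred1 c) // => q /=.
  by rewrite -!val_eqE /= cE; lia.
move=> /eqP; rewrite addr_eq0 => /eqP e; rewrite !mulrnDl !mulNrn.
by rewrite e; rewrite mulrnDl; ncring.
Qed.

End LowDegree.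

(** * Root data *)

Section CartanMatrix.
Variable n : nat.
Implicit Types i j : 'I_n.

(** An index x >= n gives 0, so that the last root of type B is a difference of consecutive terms
    like the others. *)
Definition root_eps (x : nat) : 'rV[int]_n := \row_(l < n) (l == x :> nat)%:R.

Lemma form_eps (x y : nat) :
  Defs.form (root_eps x) (root_eps y) = ((x == y) && (x < n)%N)%:R.
Proof.
rewrite /Defs.form; have [xn|xn] := boolP (x < n)%N; last first.
  rewrite andbF big1 // => l _; rewrite !mxE; case: eqP => [lx|]; last by rewrite mul0r.
  by move: xn; rewrite -lx ltn_ord.
rewrite andbT (bigD1 (Ordinal xn)) //= !mxE eqxx mul1r big1 ?addr0 // => l.
by rewrite -val_eqE /= !mxE => /negbTE ->; rewrite mul0r.
Qed.

Lemma formDl (x y z : 'rV[int]_n) : Defs.form (x + y) z = Defs.form x z + Defs.form y z.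
Proof. by rewrite -big_split; apply: eq_bigr => l _; rewrite mxE mulrDl. Qed.
Lemma formNl (x z : 'rV[int]_n) : Defs.form (- x) z = - Defs.form x z.
Proof. by rewrite -sumrN; apply: eq_bigr => l _; rewrite mxE mulNr. Qed.
Lemma formC (x z : 'rV[int]_n) : Defs.form x z = Defs.form z x.
Proof. by apply: eq_bigr => l _; rewrite mulrC. Qed.
Lemma formDr (x y z : 'rV[int]_n) : Defs.form z (x + y) = Defs.form z x + Defs.form z y.
Proof. by rewrite formC formDl formC [Defs.form y z]formC. Qed.
Lemma formNr (x z : 'rV[int]_n) : Defs.form z (- x) = - Defs.form z x.
Proof. by rewrite formC formNl formC. Qed.

Definition formE := (formDl, formDr, formNl, formNr, form_eps).

Lemma simple_rootE ty i : simple_root ty i =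
  if (if ty is typeD then i.+1 == n else false) then root_eps i.-1 + root_eps i
  else root_eps i - root_eps i.+1.
Proof.
apply/rowP => l; rewrite !mxE; have := ltn_ord l; have := ltn_ord i.
case: (ltnP i.+1 n) => [i1|i1] iN lN.
  by rewrite (ltn_eqF i1); case: ty; rewrite !mxE.
have -> : (i.+1 == n) by rewrite eqn_leq iN.
case: ty => /=; rewrite !mxE // -val_eqE.
have -> : (l == i.+1 :> nat) = false by rewrite ltn_eqF // (leq_trans lN).
by rewrite subr0.
Qed.

Lemma cartanB i j : i != j -> `|cartan typeB i j|%N =
  if i.+1 == j then 1%N else if i == j.+1 :> nat then
    if (i.+1 < n)%N then 1%N else 2 else 0%N.
Proof.
rewrite -val_eqE /cartan /= => ij; rewrite !simple_rootE /= !formE.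
have := ltn_ord i; have := ltn_ord j.
by do ![case: eqP => ? /=] => //; do ![case: ltnP => ? /=] => //; lia.
Qed.

Lemma cartanD i j : i != j -> `|cartan typeD i j|%N =
  ((root_row typeD i == root_col typeD j)
   || (root_col typeD i == root_row typeD j) :> nat).
Proof.
rewrite -val_eqE /cartan /= => ij; rewrite !simple_rootE /= -!val_eqE /=.
have := ltn_ord i; have := ltn_ord j.
do ![case: ltnP => ? /=]; do ![case: eqP => ? /=] => //; rewrite !formE;
  do ![case: eqP => ? /=]; do ?[case: ltnP => ? /=]; lia.
Qed.

End CartanMatrix.

Section RootPairs.
Variable n : nat.

(** With alpha_i at the matrix position (a, b) and alpha_j at (c, d), the Cartan integer is read off
    from b = c or a = d. The value 2 belongs to the short root of type B, whose column b is fixed by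
    '. The two end nodes of type D have a = c and fall under the first case. *)
Variant root_pair_spec ty (i j : 'I_n) : nat -> Prop :=
| RootPair0 of root_row ty i != root_col ty j & root_col ty i != root_row ty j :
    root_pair_spec ty i j 0
| RootPair1l of root_row ty i = root_col ty j : root_pair_spec ty i j 1
| RootPair1r of root_col ty i = root_row ty j
    & root_row ty i != rev_ord (root_row ty i) : root_pair_spec ty i j 1
| RootPair2 of root_col ty i = root_row ty j
    & root_row ty i = rev_ord (root_row ty i) : root_pair_spec ty i j 2.

Lemma root_pairP ty (i j : 'I_n) : valid_rank ty n -> i != j ->
  root_pair_spec ty i j `|cartan ty i j|.
Proof.
case: ty => n_valid ij; rewrite ?cartanB ?cartanD //; have iN := ltn_ord i.
- case: eqP => [ij1|ij1]; first by apply: RootPair1l; apply: val_inj.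
  case: eqP => [ji1|ji1]; last by apply: RootPair0; rewrite -val_eqE; apply/eqP.
  have ad : root_col typeB i = root_row typeB j by apply: val_inj.
  case: ltnP => i1.
    by apply: RootPair1r => //; apply: rev_ord_neq; move: i1 => /=; lia.
  by apply: RootPair2 => //; apply: val_inj => /=; lia.
- case: eqP => [bc|bc] /=; first exact: RootPair1l.
  case: eqP => [ad|ad] /=; last by apply: RootPair0; apply/eqP.
  by apply: RootPair1r => //; apply: rev_ord_neq => /=; lia.
Qed.

Lemma root_col_eq ty (i j : 'I_n) : i != j -> root_col ty i = root_col ty j ->
  root_row ty j = rev_ord (root_row ty i)
  /\ dimN ty n = ((root_col ty i).+2).*2.
Proof.
have iN := ltn_ord i; have jN := ltn_ord j.
rewrite -val_eqE => nij /(congr1 val) /= cij; suff H :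
    (dimN ty n = (root_row ty i + root_row ty j).+1
     /\ dimN ty n = ((root_col ty i).+2).*2).
  split; last by case: H.
  by case: H => {}H _; apply: val_inj; rewrite /= {1}H /=; lia.
move: cij nij => /=; case: ty => /=; first by move=> ->; rewrite eqxx.
by case: (ltnP i.+1 n); case: (ltnP j.+1 n); lia.
Qed.

End RootPairs.

(** * Serre relations for the upper triangular Gauss factor *)

Section OrthSerre.
Variables (A : nzRingType) (ty : BDtype) (n : nat).
Local Notation N := (dimN ty n).
Variables (t : 'I_N -> 'I_N -> fps A) (kap : A).
Variables (F : 'I_N -> 'I_N -> fps A) (H : 'I_N -> fps A).
Variable (E : 'I_N -> 'I_N -> fps A).
Hypothesis (os : orth_series t kap) (og : orth_gauss t F H E).
Hypothesis n_valid : valid_rank ty n.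
Hypothesis tors : forall (j : nat) (a : A), (0 < j <= 3)%N -> a *+ j = 0 -> a = 0.
Implicit Types i j : 'I_n.
Local Notation rc := (root_col ty).
Local Notation rr := (root_row ty).

(** The largest R with R + (n + 1) <= N. In type D this excludes H_n, the Cartan series that would
    tell the two end nodes apart. *)
Definition nrows : nat := if ty is typeB then n else n.-1.

Lemma nrows_cols : (nrows <= n.+1)%N /\ (nrows + n.+1 <= N)%N.
Proof. by move: n_valid; rewrite /nrows /dimN; case: ty => /=; lia. Qed.

Lemma root_col_lt i : (rc i < nrows)%N.
Proof.
have := ltn_ord i; move: n_valid; rewrite /nrows /=; case: ty => //=.
by case: (ltnP i.+1 n); lia.
Qed.

Lemma root_row_lt i : (rc i < rr i < n.+1)%N.
Proof.
have := ltn_ord i; rewrite /=; case: ty => //=; first by lia.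
by case: (ltnP i.+1 n); lia.
Qed.

Lemma root_row_next i j : (rc i < rc j)%N -> rr i = (rc i).+1 :> nat.
Proof.
have := ltn_ord i; have := ltn_ord j; rewrite /=; case: ty => //=.
by case: (ltnP i.+1 n); case: (ltnP j.+1 n); lia.
Qed.

Lemma act_self i : acts (H (rc i)) 1 (E (rc i) (rr i)).
Proof.
have [RC RCN] := nrows_cols; have := root_row_lt i => /andP[ab bC].
by apply: (acts_same os og RC RCN (root_col_lt i)); rewrite (ltnW ab).
Qed.

Lemma act_above i j : (rc i < rc j)%N -> acts (H (rc i)) 0 (E (rc j) (rr j)).
Proof.
have [RC RCN] := nrows_cols; have := root_row_lt j => /andP[ab bC] ij.
by apply: (acts_gt os og RC RCN); rewrite ?ij ?root_col_lt // (ltnW ab).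
Qed.

Lemma act_below i j : (rc j < rc i)%N ->
  exists g, acts (H (rc i)) g (E (rc j) (rr j)).
Proof.
have [RC RCN] := nrows_cols; have iR := root_col_lt i; move=> ji.
have rjE := root_row_next ji.
have : (rr j <= rc i)%N by rewrite rjE.
rewrite leq_eqVlt => /predU1P[/val_inj e|lt].
  by exists (- 1); rewrite -e; apply: (acts_next os og RC RCN) => //; rewrite e.
by exists 0; apply: (acts_lt os og RC RCN rjE); rewrite lt.
Qed.

Lemma rev_root_row i j : i != j -> rc i != rc j -> rr j != rev_ord (rr i).
Proof.
move=> ij cij; apply: rev_ord_neq; move: ij cij.
rewrite -!val_eqE /=; have := ltn_ord i; have := ltn_ord j.
case: ty => /=; first by lia.
by case: (ltnP i.+1 n); case: (ltnP j.+1 n); lia.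
Qed.

Lemma nested_comm_const (m : nat) (x y : A) :
  nested_comm (fun _ : 'I_m => x) y = iter m (lie x) y.
Proof. by elim: m => [|m IH]; rewrite ?nested_comm0 // nested_commS IH. Qed.

Lemma lieNr (x y : A) : lie x (- y) = - lie x y.
Proof. by rewrite /lie mulrN mulNr opprB opprK addrC. Qed.

(** All the inserted modes are the same, so every permutation gives the same iterated bracket in
    o_N. With alpha_i at (a, b) and alpha_j at (c, d), its steps are up to sign L_{a,d}, or L_{c,b}
    followed for the short root by L_{a,c'}; the last of them commutes with L_{a,b}. *)
Lemma serre_degree0 i j : i != j -> rc i != rc j ->
  serre_modes (E (rc i) (rr i)) (E (rc j) (rr j))
    (fun _ : 'I_(1 + `|cartan ty i j|) => 0%N) 0 = 0.
Proof.
move=> ij cij; rewrite /serre_modes /serre big1 // => s _.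
have [RC RCN] := nrows_cols.
have /andP[ab bC] := root_row_lt i; have /andP[cd dC] := root_row_lt j.
have aR := root_col_lt i; have cR := root_col_lt j.
rewrite nested_comm_const !(gauss_E1 og) //.
have rneq (p q : 'I_N) : (p < nrows)%N -> (q < n.+1)%N -> p != rev_ord q.
  by move=> pR qC; apply: rev_ord_neq; lia.
have rowE := bracketL os; have row0 := bracketL0 os.
have dneq : rc i != rr i /\ rc j != rr j by rewrite -!val_eqE /= !ltn_eqF.
case: dneq => dab dcd.
have db := rev_root_row ij cij.
have rrow (p q : 'I_n) : rc p != rev_ord (rr q).
  by have /andP[_ qC] := root_row_lt q; apply: rneq (root_col_lt p) qC.
have rcol (p q : 'I_n) : rc p != rev_ord (rc q).
  exact: rneq (root_col_lt p) (leq_trans (root_col_lt q) RC).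
case: root_pairP => // [bc ad|bc|ad bb|ad bb] /=.
- by apply: row0; rewrite // 1?eq_sym.
- have nad : rc i != rr j by rewrite -val_eqE ltn_eqF // (ltn_trans ab) // bc.
  have -> : lie (t (rc i) (rr i) 1%N) (t (rc j) (rr j) 1%N) = t (rc i) (rr j) 1%N.
    rewrite rowE bc eqxx (negbTE nad) (negbTE (rcol j i)) -bc (negbTE db).
    by rewrite !mul0r mul1r; ncring.
  by apply: row0.
- have ncb : rc j != rr i by rewrite -val_eqE ltn_eqF // (ltn_trans cd) // -ad.
  have -> : lie (t (rc i) (rr i) 1%N) (t (rc j) (rr j) 1%N) = - t (rc j) (rr i) 1%N.
    rewrite rowE -ad eqxx (negbTE ncb) (negbTE (rcol j i)) (negbTE (rrow i i)).
    by rewrite !mul0r mul1r; ncring.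
  by rewrite lieNr row0 ?oppr0.
- have ncb : rc j != rr i by rewrite -val_eqE ltn_eqF // (ltn_trans cd) // -ad.
  have -> : lie (t (rc i) (rr i) 1%N) (t (rc j) (rr j) 1%N) = - t (rc j) (rr i) 1%N.
    rewrite rowE -ad eqxx (negbTE ncb) (negbTE (rcol j i)) (negbTE (rrow i i)).
    by rewrite !mul0r mul1r; ncring.
  have -> : lie (t (rc i) (rr i) 1%N) (- t (rc j) (rr i) 1%N)
      = t (rc i) (rev_ord (rc j)) 1%N.
    rewrite lieNr rowE (negbTE ncb) (negbTE dab) (negbTE (rcol j i)) -bb eqxx.
    by rewrite !mul0r mul1r; ncring.
  by apply: row0; rewrite // (inj_eq rev_ord_inj).
Qed.

Lemma serre_modes1 (e f : fps A) (a s : nat) :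
  serre_modes e f (fun _ : 'I_1 => a) s = lie (e a.+1) (f s.+1).
Proof.
rewrite /serre_modes /serre (big_pred1 1%g) => [|sg].
  by rewrite nested_commS nested_comm0.
by apply/esym/eqP/permP => i; rewrite (ord1 (sg i)) (ord1 (_ i)).
Qed.

(** Of two distinct rows, the upper one carries a Cartan series of weight 1 on its own node and 0 on
    the other, and the lower one has weight 1 on its own node: the triangular situation. Equal rows
    occur only for the end nodes of type D. *)
Lemma orth_serre i j (m : nat) (r : 'I_m -> nat) (s : nat) :
  i != j -> m = (1 + `|cartan ty i j|)%N ->
  serre_modes (E (rc i) (rr i)) (E (rc j) (rr j)) r s = 0.
Proof.
move=> ij mE; rewrite {m}mE in r *.
have torsm (k : nat) (z : A) : (0 < k <= 1 + `|cartan ty i j|)%N -> z *+ k = 0 -> z = 0.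
  by case: (root_pairP n_valid ij) => [?|?|?|?] *; apply: tors; eauto; lia.
have H0 p : H p 0%N = 1 := og_H og p.
case: (ltngtP (rc i) (rc j)) => [lt|gt|/val_inj eq].
- have [g gE] := act_below lt.
  apply: (@serre_vanish_left _ _ _ _ (H (rc i)) (H (rc j)) g) => //.
  + exact: act_self.
  + exact: act_above.
  + exact: act_self.
  + by apply: serre_degree0; rewrite // -val_eqE ltn_eqF.
- have [g gE] := act_below gt.
  apply: (@serre_vanish_right _ _ _ _ (H (rc j)) (H (rc i)) g) => //.
  + exact: act_above.
  + exact: act_self.
  + exact: act_self.
  + by apply: serre_degree0; rewrite // -val_eqE gtn_eqF.
have [bb NE] := root_col_eq ij eq.
have /andP[ab bC] := root_row_lt i; have /andP[ab' _] := root_row_lt j.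
have tors2 (z : A) : z *+ 2 = 0 -> z = 0 by apply: tors.
have aa : rc i != rev_ord (rc i) by apply: rev_ord_neq; move: NE; lia.
(* Equal rows exclude b = c and a = d, so the roots are orthogonal and the Serre sum is a single
   bracket. *)
have r1 : (1 + `|cartan ty i j|)%N = 1%N.
  have neq (p q : 'I_N) : (p < q)%N -> p <> q by move=> pq e; rewrite e ltnn in pq.
  case: root_pairP => // [bc|ad _|ad _].
  - by case: (neq _ _ ab); rewrite bc.
  - by case: (neq _ _ ab'); rewrite -ad.
  - by case: (neq _ _ ab'); rewrite -ad.
move: r; rewrite r1 => r.
apply: (serre_vanish_diag tors2 (H0 (rc i))).
- exact: act_self.
- by rewrite eq; apply: act_self.
- rewrite serre_modes1 !(gauss_E1 og) // bb -eq (bracket_isotropic os) //.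
  + by rewrite (L_isotropic os) ?oppr0.
  + by rewrite -val_eqE ltn_eqF.
  + by rewrite -bb eq -val_eqE ltn_eqF.
- rewrite serre_modes1 [E (rc j) _ _](gauss_E1 og) // bb -eq.
  by apply: (isotropic_degree1 os og); rewrite // -bb eq.
Qed.

End OrthSerre.

(** * The extended Yangian *)

Section Converse.
Variable A : nzRingType.

Lemma fps_converseM (f g : fps A) : (f : fps A^c) * g = (g * f : fps A).
Proof.
apply: funext => n; rewrite [RHS]fpsME (reindex_inj rev_ord_inj) /=.
rewrite [LHS](@fpsME A^c); apply: eq_bigr => i _.
by rewrite subSS subKn // -ltnS.
Qed.

Lemma nested_comm_converse (m : nat) (z : 'I_m -> A) (y : A) :
  nested_comm (z : 'I_m -> A^c) (y : A^c) = (-1) ^+ m * nested_comm z y :> A.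
Proof.
elim: m z => [|m IH] z; first by rewrite !nested_comm0 mul1r.
rewrite (@nested_commS A^c) IH nested_commS exprS mulN1r mulNr.
set n := nested_comm _ y; suff : (-1) ^+ m * n * z ord0 - z ord0 * ((-1) ^+ m * n)
  = - ((-1) ^+ m * lie (z ord0) n) by [].
by rewrite -signr_odd /lie; case: (odd m); rewrite ?expr0 ?expr1; ncring.
Qed.

End Converse.

Section YangianSeries.
Variables (k : closedFieldType) (N : nat).
Local Notation Y := (yangian k N).

Definition yt (i j : 'I_N) : fps Y := fun r => tcoef (tgen k (N := N)) i j r.
Definition yF (i j : 'I_N) : fps Y := fun r => fser k N r i j.
Definition yH (i : 'I_N) : fps Y := fun r => hser k N r i i.
Definition yE (i j : 'I_N) : fps Y := fun r => eser k N r i j.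

Lemma yt_orth : orth_series yt (kappa k N)%:A.
Proof.
split=> [z|//|i j l m r s]; first by rewrite mulr_algl mulr_algr.
have tE a b c : ocoef yt a b c = tcoef (tgen k (N := N)) a b c by case: c.
have cE a b : ocomm yt i j l m a b = tcomm (tgen k (N := N)) i j l m a b.
  by rewrite /ocomm !tE.
have sE a b : oswap yt i j l m a b = tswap (tgen k (N := N)) i j l m a b.
  by rewrite /oswap !tE.
have trE a b : otrace yt i j l m a b = ttrace (tgen k (N := N)) i j l m a b.
  by rewrite /otrace; congr (_ * _ - _ * _); apply: eq_bigr => q _; rewrite !tE.
have oE (c : k) f g a b : (forall a b, f a b = g a b :> Y) ->
    omul c%:A f a b = mul_uvc c g a b.
  by move=> fg; rewrite /omul /mul_uvc !fg mulr_algl.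
have o0 f g a b : (forall a b, f a b = g a b :> Y) -> omul 0 f a b = mul_uvc 0 g a b.
  by move=> fg; rewrite /omul /mul_uvc !fg mul0r scale0r.
have e1 : omul 0 (omul (kappa k N)%:A (ocomm yt i j l m)) r s
    = mul_uvc 0 (mul_uvc (kappa k N) (tcomm (tgen k (N := N)) i j l m)) r s.
  by apply: (o0) => a b; apply: (oE) => a1 b1; apply: (cE).
have e2 : omul (kappa k N)%:A (oswap yt i j l m) r s
    = mul_uvc (kappa k N) (tswap (tgen k (N := N)) i j l m) r s.
  by apply: (oE) => a b; apply: (sE).
have e3 : omul 0 (otrace yt i j l m) r s
    = mul_uvc 0 (ttrace (tgen k (N := N)) i j l m) r s.
  by apply: (o0) => a b; apply: (trE).
have /eqP := tgen_rel k i j l m r s; rewrite /yrel subr_eq0 => /eqP e4.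
exact: etrans e1 (etrans e4 (esym (congr2 (fun x y => x - y) e2 e3))).
Qed.

Lemma y_gauss : orth_gauss yt yF yH yE.
Proof.
have [F0 H0 E0] := gauss0 (tser0 k N) (gaussP k N).
have [TE Fu Hd Eu] := gaussP k N.
have F_ij r (i j : 'I_N) : (i < j)%N -> fser k N r i j = 0.
  by move=> ij; have [/is_trig_mxP Ft _] := Fu r; apply: Ft.
have E_ij r (i j : 'I_N) : (j < i)%N -> eser k N r i j = 0.
  by move=> ij; have [/is_trig_mxP Et _] := Eu r; have := Et _ _ ij; rewrite mxE.
split.
- move=> i j; apply: fpsP => r; rewrite fps_sumE.
  transitivity ((tser k N r) i j); first by rewrite mxE.
  rewrite TE /mulser summxE; under eq_bigr do rewrite mxE.
  rewrite exchange_big; apply: eq_bigr => m _ /=.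
  rewrite fpsME; apply: eq_bigr => a _; congr (_ * _).
  rewrite summxE fpsME; apply: eq_bigr => b _.
  rewrite mxE (bigD1 m) //= big1 ?addr0 // => q qm.
  by have /is_diag_mxP -> := Hd (a - b)%N; rewrite ?mulr0.
- by move=> i; apply: fpsP => r; have [_ Fd] := Fu r; rewrite /yF Fd fps1E.
- by move=> i j ij; apply: fpsP => r; rewrite /yF F_ij.
- by move=> i j; rewrite /yF F0 mxE.
- by move=> i; rewrite /yH H0 mxE eqxx.
- by move=> i j; rewrite /yE E0 mxE.
- by move=> i; apply: fpsP => r; have [_ /(_ i)] := Eu r; rewrite mxE fps1E.
- by move=> i j ij; apply: fpsP => r; rewrite /yE E_ij.
Qed.

End YangianSeries.

Section ConverseGauss.
Variables (A : nzRingType) (N : nat) (t F E : 'I_N -> 'I_N -> fps A).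
Variable H : 'I_N -> fps A.

Lemma orth_gauss_converse : orth_gauss t F H E ->
  @orth_gauss A^c N (converse_tr t) (converse_tr E) H (converse_tr F).
Proof.
case=> tE F1 F0 Fc Hc Ec E1 E0; split=> //.
- move=> i j; rewrite /converse_tr tE; apply: fpsP => r.
  rewrite [LHS]fps_sumE [RHS](@fps_sumE A^c); apply: eq_bigr => m _.
  by rewrite !fps_converseM mulrA.
- by move=> i j ij; apply: E0.
- by move=> i j; rewrite eq_sym; apply: Ec.
- by move=> i j; rewrite eq_sym; apply: Fc.
- by move=> i j ij; apply: F0.
Qed.

Lemma serre_converse (m : nat) (z : 'I_m -> A) (y : A) :
  @serre A^c m z y = 0 -> serre z y = 0.
Proof.
have -> : @serre A^c m z y = (-1) ^+ m * serre z y :> A.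
  rewrite /serre mulr_sumr; apply: eq_bigr => s _.
  exact: (nested_comm_converse (fun l => z (s l))).
by move=> /eqP; rewrite (mulrI_eq0 _ (@lreg_sign A m)) => /eqP.
Qed.

End ConverseGauss.

(** * Multilinearity and shifts of the spectral parameter *)

Section Multilinear.
Variables (k : comNzRingType) (A : algType k).

Lemma lie_suml (I : finType) (x : I -> A) (y : A) :
  lie (\sum_i x i) y = \sum_i lie (x i) y.
Proof. by rewrite /lie mulr_sumr mulr_suml -sumrB. Qed.

Lemma lieZ (a b : k) (x y : A) : lie (a *: x) (b *: y) = (a * b) *: lie x y.
Proof.
by rewrite /lie -!scalerAl -!scalerAr !scalerA [b * a]mulrC scalerBr.
Qed.

Lemma nested_comm_sum (m Q : nat) (z : 'I_m -> 'I_Q -> A) (y : 'I_Q -> A) :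
  nested_comm (fun l => \sum_q z l q) (\sum_q y q)
  = \sum_(c : {ffun 'I_m -> 'I_Q}) \sum_q nested_comm (fun l => z l (c l)) (y q).
Proof.
elim: m z => [|m IH] z.
  rewrite nested_comm0 (big_pred1 (ffun0 (card_ord 0))) => [|c].
    by apply: eq_bigr => q _; rewrite nested_comm0.
  by apply/esym/eqP/ffunP => -[].
rewrite nested_commS IH lie_suml.
transitivity (\sum_q \sum_(c : {ffun 'I_m -> 'I_Q}) \sum_p
  lie (z ord0 q) (nested_comm (fun l => z (lift ord0 l) (c l)) (y p))).
  apply: eq_bigr => q _; rewrite lie_sumr; apply: eq_bigr => c _.
  by rewrite lie_sumr.
rewrite (big_ffun_ordS (fun q (c : {ffun 'I_m -> 'I_Q}) => \sum_p
  lie (z ord0 q) (nested_comm (fun l => z (lift ord0 l) (c l)) (y p)))).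
apply: eq_bigr => c _; apply: eq_bigr => q _; rewrite nested_commS.
by under eq_nested_comm do rewrite ffunE.
Qed.

Lemma nested_commZ (m : nat) (z : 'I_m -> A) (y : A) (a : 'I_m -> k) (b : k) :
  nested_comm (fun l => a l *: z l) (b *: y)
  = (b * \prod_l a l) *: nested_comm z y.
Proof.
elim: m z a => [|m IH] z a; first by rewrite !nested_comm0 big_ord0 mulr1.
by rewrite !nested_commS IH lieZ big_ord_recl mulrCA.
Qed.

Lemma serre_sum (m Q : nat) (z : 'I_m -> 'I_Q -> A) (y : 'I_Q -> A) :
  serre (fun l => \sum_q z l q) (\sum_q y q)
  = \sum_(c : {ffun 'I_m -> 'I_Q}) \sum_q serre (fun l => z l (c l)) (y q).
Proof.
rewrite /serre.
transitivity (\sum_(s : 'S_m) \sum_(c : {ffun 'I_m -> 'I_Q}) \sum_q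
   nested_comm (fun l => z (s l) (c (s l))) (y q)).
  apply: eq_bigr => s _; rewrite (nested_comm_sum (fun l => z (s l))).
  pose h (c : {ffun 'I_m -> 'I_Q}) := [ffun l => c (s l)].
  rewrite (reindex h) /=; last first.
    exists (fun c : {ffun 'I_m -> 'I_Q} => [ffun l => c ((s^-1)%g l)]) => c _;
      by apply/ffunP => l; rewrite !ffunE ?permK ?permKV.
  apply: eq_bigr => c _; apply: eq_bigr => q _.
  by under eq_nested_comm do rewrite ffunE.
rewrite exchange_big; apply: eq_bigr => c _; rewrite exchange_big.
by apply: eq_bigr => q _.
Qed.

Lemma serreZ (m : nat) (z : 'I_m -> A) (y : A) (a : 'I_m -> k) (b : k) :
  serre (fun l => a l *: z l) (b *: y) = (b * \prod_l a l) *: serre z y.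
Proof.
rewrite /serre scaler_sumr; apply: eq_bigr => s _.
rewrite (nested_commZ (fun l => z (s l)) y (fun l => a (s l))).
by congr ((_ * _) *: _); rewrite [RHS](reindex_inj (@perm_inj _ s)).
Qed.

Lemma shift_modes (c : k) (f : nat -> A) (s Q : nat) : f 0%N = 0 -> (s <= Q)%N ->
  exists a : nat -> k, shift c f s = \sum_(q < Q) a q *: f q.+1.
Proof.
move=> f0 sQ; pose a q : k := 'C(s.-1, s - q)%:R * c ^+ (s - q).
exists (fun q => if (q < s)%N then a q.+1 else 0).
rewrite /shift big_ord_recl f0 scaler0 add0r.
rewrite (big_ord_widen Q (fun q => a q.+1 *: f q.+1) sQ) big_mkcond.
by apply: eq_bigr => q _; case: ifP => // _; rewrite scale0r.
Qed.

(* Shifting the argument of the series only mixes their coefficients. *)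
Lemma serre_shift (m : nat) (c d : k) (e f : nat -> A) (r : 'I_m -> nat) (s : nat) :
  e 0%N = 0 -> f 0%N = 0 ->
  (forall r' s', serre (fun l : 'I_m => e (r' l).+1) (f s'.+1) = 0) ->
  serre (fun l => shift c e (r l)) (shift d f s) = 0.
Proof.
move=> e0 f0 S0; pose Q := (\sum_l r l + s)%N.
have rQ l : (r l <= Q)%N by rewrite /Q (bigD1 l) //= -addnA leq_addr.
have /boolp.choice[a aE] := fun l => shift_modes c e0 (rQ l).
have [b ->] := shift_modes d f0 (leq_addl (\sum_l r l) s : (s <= Q)%N).
rewrite (eq_serre _ aE) serre_sum big1 // => c' _; rewrite big1 // => q _.
by rewrite (serreZ (fun l => e (c' l).+1)) S0 scaler0.
Qed.

End Multilinear.

Theorem propositionA3 (k : closedFieldType) (p : nat) (ty : BDtype) (n : nat)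
    (i j : 'I_n) (m : nat) (sg : sign) (r : 'I_m -> nat) (s : nat) :
  p \in [pchar k] -> (3 < p)%N -> valid_rank ty n ->
  i != j -> m = (1 + `|cartan ty i j|)%N ->
  \sum_(sigma : 'S_m)
     nested_comm (fun l : 'I_m => xi k ty sg i (r (sigma l))) (xi k ty sg j s)
  = 0.
Proof.
move=> chp p3 nv ij mE.
have tors (q : nat) (a : yangian k (dimN ty n)) : (0 < q <= 3)%N -> a *+ q = 0 -> a = 0.
  move=> /andP[q0 q3] /eqP; rewrite -scaler_nat scaler_eq0 => /orP[|/eqP//].
  by rewrite -(dvdn_pcharf chp) gtnNdvd // (leq_ltn_trans q3).
have os := yt_orth k (dimN ty n); have og := y_gauss k (dimN ty n).
have nrc (x : 'I_n) : root_col ty x != root_row ty x.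
  by rewrite -val_eqE ltn_eqF //; case/andP: (root_row_lt nv x).
have nrc' (x : 'I_n) : root_row ty x != root_col ty x by rewrite eq_sym.
rewrite -[LHS]/(serre (fun l => xi k ty sg i (r l)) (xi k ty sg j s)).
(* The mode r is the coefficient of u^-(r + 1). The constant terms vanish because the entries are
   off the diagonal. *)
case: sg; rewrite /xi /xi_ser;
  apply: (@serre_shift _ _ m _ _ _ _ (fun l => (r l).+1) s.+1).
- by apply: etrans (og_F og _ _) _; rewrite (negbTE (nrc' i)).
- by apply: etrans (og_F og _ _) _; rewrite (negbTE (nrc' j)).
- move=> r' s'; apply: serre_converse.
  exact: (orth_serre (orth_series_converse os) (orth_gauss_converse og) nv tors).
- by apply: etrans (og_E og _ _) _; rewrite (negbTE (nrc i)).
- by apply: etrans (og_E og _ _) _; rewrite (negbTE (nrc j)).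
- by move=> r' s'; apply: (orth_serre os og nv tors).
Qed.
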